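(* For any singular Borel probability measure $\mu$ on $\mathbb{R}$, there is a Parseval frame $\{c_{nm}\}_{n,m=0}^{\infty}\subseteq L^2(\mu)$ for $L^2(\mu)$ such that for every $f\in L^2(\mu)$, $$f(y)=\sum_{n=0}^{\infty}\sum_{m=0}^{\infty}\langle f,c_{nm}\rangle_{\mu}\,e^{im\lfloor y\rfloor}e^{2\pi i n y},$$ where, for each $n$, the inner sum (over $m$) is first taken as a limit in $L^2(\mu)$, and then the outer sum (over $n$) is taken as a limit in $L^2(\mu)$.
   Context: ''Singular'' means singular with respect to Lebesgue measure. A family $\{c_j\}$ in a Hilbert space $H$ is a Parseval frame for $H$ if $\sum_j|\langle f,c_j\rangle|^2=\|f\|^2$ for all $f\in H$. $\lfloor y\rfloor$ is the greatest integer not exceeding $y$. *)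

(* Defs.v *)
From HB Require Import structures.
From mathcomp Require Import all_boot all_order all_algebra.
From mathcomp Require Import all_classical all_reals all_analysis.
From mathcomp Require Import complex.

Set Implicit Arguments.
Unset Strict Implicit.
Unset Printing Implicit Defensive.

Import Order.TTheory GRing.Theory Num.Theory.
Import numFieldNormedType.Exports.

Local Open Scope classical_set_scope.
Local Open Scope ring_scope.

Definition mutually_singular d (T : measurableType d) (R : realType)
    (mu nu : set T -> \bar R) : Prop :=
  exists A : set T, [/\ measurable A, mu A = 0%E & nu (~` A) = 0%E].

(* MathComp-Analysis has L^p spaces of real-valued functions only.  Elements of
   the complex L^2(mu) are handled through representatives: functions are
   compared by their L^2 distance, i.e., up to equality mu-almost everywhere. *)
Section complexL2.
Context {d} {T : measurableType d} {R : realType}.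
Variable mu : {measure set T -> \bar R}.
Implicit Types f g : T -> R[i].

Definition L2norm f : \bar R :=
  Lnorm mu 2%:E (fun x => (ComplexField.Normc.normc (f x))%:E).

Definition inL2 f : Prop :=
  [/\ measurable_fun [set: T] (fun x => complex.Re (f x)),
      measurable_fun [set: T] (fun x => complex.Im (f x)) &
      (L2norm f < +oo)%E].

Definition cintegral f : R[i] :=
  ((\int[mu]_x complex.Re (f x)) +i* (\int[mu]_x complex.Im (f x)))%C.

Definition inner f g : R[i] := cintegral (fun x => f x * (g x)^*%C).

Definition parseval_frame (J : choiceType) (c : J -> T -> R[i]) : Prop :=
  (forall j, inL2 (c j)) /\
  forall f, inL2 f ->
    (\esum_(j in [set: J]) ((ComplexField.Normc.normc (inner f (c j))) ^+ 2)%:E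
     = L2norm f ^+ 2)%E.

Definition L2_series_sum (u : nat -> T -> R[i]) (s : T -> R[i]) : Prop :=
  [/\ forall k, inL2 (u k), inL2 s &
      (fun K : nat => L2norm (fun x => \sum_(k < K) u k x - s x)) @ \oo
        --> 0%E].

End complexL2.

Definition expi {R : realType} (t : R) : R[i] := (cos t +i* sin t)%C.

(* Main.v *)
Require Import Defs.
From HB Require Import structures.
From mathcomp Require Import all_boot all_order all_algebra.
From mathcomp Require Import all_classical all_reals all_analysis.
From mathcomp Require Import complex.
From mathcomp Require Import measurable_realfun ring lra.

Set Implicit Arguments.
Unset Strict Implicit.
Unset Printing Implicit Defensive.

Import Order.TTheory GRing.Theory Num.Theory.
Import numFieldNormedType.Exports.

Local Open Scope classical_set_scope.
Local Open Scope ring_scope.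

(* The Kaczmarz algorithm along unit vectors [U^n e], U unitary, replaces f by
   A f = U^-1 (f - <f, e> e) at each step, and
   |f|^2 = |A^N f|^2 + sum_(n < N) |<A^n f, e>|^2.  When A^N f -> 0 one gets the
   expansion of f in the [U^n e], and since <A^n f, e> = <f, B^n e>, B the adjoint
   of A, the vectors B^n e form a Parseval frame.

   A^N tends to 0 on the closed span of the [U^l e] as soon as it does at
   U^-1 e.  Let 1 - s be the function on the circle whose coefficients are those
   of U^-1 e, shifted by one.  For a real trigonometric polynomial p the
   coefficients of p(U) e sum to p + q s, where 2 Re q = <p(U) e, e> - p.  If the
   spectral measure of e is singular, one can take p close to 1 for that measure
   and close to 0 for Lebesgue measure; then q s is close to 1 and 2 Re q to 1,
   so |1 - s| is close to 1 in L^2, i.e. no energy is lost.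

   On the line this is applied twice: with multiplication by e^(2 pi i y) on each
   interval [k, k + 1), all intervals being treated at once by replacing
   <f, e> e with the conditional expectation E f given the integer part; and with
   multiplication by e^(i floor(y)) to the functions E (A^n f) of the integer
   part, whose spectral measure is carried by the countable set {e^(ik)}.  The
   points e^(ik) are distinct because pi is irrational. *)

(** * Complex L^2 spaces *)

(** The power series involved have boundary values only as L^2 limits on the circle. To avoid Hardy
    spaces, every identity is stated for partial sums of length N at points of modulus 1; truncation
    costs a single term, and it tends to 0 because the coefficients are square summable. The circle
    with Lebesgue measure enters only as a probability space carrying a unimodular function with
    orthonormal powers, so that an interval [k, k + 1) with e^(2 pi i y) can serve.

    The polynomial p is found in two ways. On an interval it approximates the indicator of a set
    that is Lebesgue null and carries mu, in L^2 of the sum of both measures; density of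
    trigonometric polynomials comes from a sigma-algebra argument instead of Stone-Weierstrass. For
    functions of the integer part it is built from explicit Cesaro means, tending to 1 at one point
    e^(ik) and to 0 at the others.

    The rate of decay of A^N f may depend on the interval. Decay is therefore proved vector by
    vector: A being a contraction, the vectors with A^N f -> 0 form a closed subspace, and functions
    supported by one interval suffice. *)

Section complex_modulus.
Context {R : realType}.
Local Notation C := R[i].
Implicit Types x y : C.

(** The squared modulus as a real polynomial in the two parts, so that estimates reduce to [ring]
    and [nra] without square roots. *)
Definition sqn x : R := (complex.Re x) ^+ 2 + (complex.Im x) ^+ 2.

Lemma sqn_ge0 x : 0 <= sqn x.
Proof. by rewrite addr_ge0// sqr_ge0. Qed.

Lemma normc_sq x : ComplexField.Normc.normc x ^+ 2 = sqn x.
Proof. by case: x => a b; rewrite /= sqr_sqrtr// addr_ge0// sqr_ge0. Qed.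

Lemma mulcJ x : x * x^*%C = (sqn x)%:C%C.
Proof. by case: x => a b; rewrite /sqn; simpc; congr (_ +i* _)%C; ring. Qed.

Lemma mulJc x : x^*%C * x = (sqn x)%:C%C.
Proof. by rewrite mulrC mulcJ. Qed.

Lemma sqnM x y : sqn (x * y) = sqn x * sqn y.
Proof. by case: x y => [a b] [c d]; rewrite /sqn; simpc => /=; ring. Qed.

Lemma sqnX x n : sqn (x ^+ n) = sqn x ^+ n.
Proof.
elim: n => [|n IH]; first by rewrite !expr0 /sqn /= expr0n expr1n addr0.
by rewrite !exprS sqnM IH.
Qed.

Lemma sqnJ x : sqn x^*%C = sqn x.
Proof. by case: x => a b; rewrite /sqn /= sqrrN. Qed.

Lemma sqnN x : sqn (- x) = sqn x.
Proof. by case: x => a b; rewrite /sqn /= !sqrrN. Qed.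

Lemma sqn0 : sqn 0 = 0.
Proof. by rewrite /sqn /= expr0n addr0. Qed.

Lemma sqn1 : sqn 1 = 1.
Proof. by rewrite /sqn /= expr0n expr1n addr0. Qed.

Lemma sqnR (a : R) : sqn a%:C%C = a ^+ 2.
Proof. by rewrite /sqn /= expr0n addr0. Qed.

Lemma sqn_eq0 x : sqn x = 0 -> x = 0.
Proof.
case: x => a b /eqP; rewrite /sqn /= paddr_eq0 ?sqr_ge0//.
by rewrite !sqrf_eq0 => /andP[/eqP-> /eqP->].
Qed.

Lemma sqnD_le x y : sqn (x + y) <= 2 * sqn x + 2 * sqn y.
Proof.
case: x y => [a b] [c d]; rewrite /sqn /=.
have := sqr_ge0 (a - c); have := sqr_ge0 (b - d); nra.
Qed.

Lemma Re_sq_le x : complex.Re x ^+ 2 <= sqn x.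
Proof. by rewrite /sqn lerDl sqr_ge0. Qed.

Lemma cReD x y : complex.Re (x + y) = complex.Re x + complex.Re y.
Proof. by case: x y => [a b] [c d]. Qed.

Lemma cImD x y : complex.Im (x + y) = complex.Im x + complex.Im y.
Proof. by case: x y => [a b] [c d]. Qed.

Lemma cReM x y :
  complex.Re (x * y) = complex.Re x * complex.Re y - complex.Im x * complex.Im y.
Proof. by case: x y => [a b] [c d]. Qed.

Lemma cImM x y :
  complex.Im (x * y) = complex.Re x * complex.Im y + complex.Im x * complex.Re y.
Proof. by case: x y => [a b] [c d]. Qed.

Lemma cReJ x : complex.Re x^*%C = complex.Re x.
Proof. by case: x. Qed.

Lemma cImJ x : complex.Im x^*%C = - complex.Im x.
Proof. by case: x. Qed.

Lemma Re_mulJ_le x y : `|complex.Re (x * y^*%C)| <= sqn x + sqn y.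
Proof.
rewrite cReM cReJ cImJ /sqn ler_norml.
case: x y => [a b] [c e] /=.
have := sqr_ge0 (a + c); have := sqr_ge0 (b + e); have := sqr_ge0 (a + e).
have := sqr_ge0 (a - c); have := sqr_ge0 (b - e); have := sqr_ge0 (a - e).
have := sqr_ge0 (b + c); have := sqr_ge0 (b - c).
by move=> *; apply/andP; split; nra.
Qed.

Lemma Im_mulJ_le x y : `|complex.Im (x * y^*%C)| <= sqn x + sqn y.
Proof.
rewrite cImM cReJ cImJ /sqn ler_norml.
case: x y => [a b] [c e] /=.
have := sqr_ge0 (a + c); have := sqr_ge0 (b + e); have := sqr_ge0 (a + e).
have := sqr_ge0 (a - c); have := sqr_ge0 (b - e); have := sqr_ge0 (a - e).
have := sqr_ge0 (b + c); have := sqr_ge0 (b - c).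
by move=> *; apply/andP; split; nra.
Qed.

Lemma eqc x y :
  complex.Re x = complex.Re y -> complex.Im x = complex.Im y -> x = y.
Proof. by case: x y => [a b] [c d] /= -> ->. Qed.

Lemma sqn1_inv x : sqn x = 1 -> x^-1 = x^*%C.
Proof.
move=> x1; have xu : x * x^*%C = 1 by rewrite mulcJ x1.
have x0 : x != 0.
  by apply/eqP => x0; move/eqP: xu; rewrite x0 mul0r eq_sym oner_eq0.
by apply: (mulfI x0); rewrite xu divff.
Qed.

End complex_modulus.

Section L2_space.
Context {d} {T : measurableType d} {R : realType}.
Local Notation C := R[i].

Definition cmeasurable (f : T -> C) :=
  measurable_fun [set: T] (fun x => complex.Re (f x)) /\
  measurable_fun [set: T] (fun x => complex.Im (f x)).

Lemma cmeasurableD f g :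
  cmeasurable f -> cmeasurable g -> cmeasurable (fun x => f x + g x).
Proof.
move=> [f1 f2] [g1 g2]; split.
  by under eq_fun do rewrite cReD; exact: measurable_funD.
by under eq_fun do rewrite cImD; exact: measurable_funD.
Qed.

Lemma cmeasurableM f g :
  cmeasurable f -> cmeasurable g -> cmeasurable (fun x => f x * g x).
Proof.
move=> [f1 f2] [g1 g2]; split.
  under eq_fun do rewrite cReM.
  by apply: measurable_funB; exact: measurable_funM.
under eq_fun do rewrite cImM.
by apply: measurable_funD; exact: measurable_funM.
Qed.

Lemma cmeasurable_cst (c : C) : cmeasurable (fun=> c).
Proof. by split; exact: measurable_cst. Qed.

Lemma cmeasurableJ f : cmeasurable f -> cmeasurable (fun x => (f x)^*%C).
Proof.
move=> [f1 f2]; split; first by under eq_fun do rewrite cReJ.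
by under eq_fun do rewrite cImJ; exact: measurableT_comp.
Qed.

Lemma cmeasurableN f : cmeasurable f -> cmeasurable (fun x => - f x).
Proof.
move=> mf; have := cmeasurableM (cmeasurable_cst (-1)) mf.
by under eq_fun do rewrite mulN1r.
Qed.

Lemma cmeasurable_real (f : T -> R) :
  measurable_fun [set: T] f -> cmeasurable (fun x => (f x)%:C%C).
Proof. by move=> mf; split => //=; exact: measurable_cst. Qed.

Lemma cmeasurableX f n : cmeasurable f -> cmeasurable (fun x => f x ^+ n).
Proof.
move=> mf; elim: n => [|n IH].
  by under eq_fun do rewrite expr0; exact: cmeasurable_cst.
by under eq_fun do rewrite exprS; exact: cmeasurableM.
Qed.

Lemma measurable_sqn f : cmeasurable f ->
  measurable_fun [set: T] (fun x => sqn (f x)).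
Proof.
by move=> [f1 f2]; apply: measurable_funD; exact: measurable_funX.
Qed.

Lemma emeasurable_sqn f : cmeasurable f ->
  measurable_fun [set: T] (fun x => (sqn (f x))%:E).
Proof. by move=> mf; apply/measurable_EFinP; exact: measurable_sqn. Qed.

Lemma emeasurable_sqnZ f (c : R) : cmeasurable f ->
  measurable_fun [set: T] (fun x => (c * sqn (f x))%:E).
Proof.
by move=> mf; apply/measurable_EFinP/measurable_funM => //; exact: measurable_sqn.
Qed.

Variable mu : {measure set T -> \bar R}.

Lemma L2normE (f : T -> C) :
  L2norm mu f = ((\int[mu]_x (sqn (f x))%:E) `^ (2^-1))%E.
Proof.
rewrite /L2norm unlock /=; congr (_ `^ _)%E; apply: eq_integral => x _.
rewrite ger0_norm; last by case: (f x) => a b; exact: sqrtr_ge0.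
by rewrite -normc_sq powR_mulrn//; case: (f x) => a b; exact: sqrtr_ge0.
Qed.

Lemma int_sqn_ge0 (f : T -> C) : (0 <= \int[mu]_x (sqn (f x))%:E)%E.
Proof. by apply: integral_ge0 => x _; rewrite lee_fin sqn_ge0. Qed.

Lemma L2norm_sq (f : T -> C) :
  (L2norm mu f ^+ 2 = \int[mu]_x (sqn (f x))%:E)%E.
Proof.
rewrite L2normE; have := int_sqn_ge0 f.
case: (integral mu _ _) => [r| |] //.
  by rewrite lee_fin => r0; rewrite poweR_EFin -EFin_expe powR12_sqrt// sqr_sqrtr.
by move=> _; rewrite poweRyr ?invr_eq0 ?pnatr_eq0// expe2 mulyy.
Qed.

Lemma inL2P (f : T -> C) :
  inL2 mu f <-> cmeasurable f /\ (\int[mu]_x (sqn (f x))%:E < +oo)%E.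
Proof.
split.
  move=> [mr mi fin]; split; first by split.
  rewrite -L2norm_sq expe2 -ge0_fin_numE ?mule_ge0// ?Lnorm_ge0//.
  by rewrite fin_numM// ge0_fin_numE ?Lnorm_ge0.
move=> [[mr mi] fin]; split => //.
by rewrite L2normE poweR_lty.
Qed.

Lemma inL2_le f g : cmeasurable f -> inL2 mu g ->
  (exists2 c : R, 0 <= c & forall x, sqn (f x) <= c * sqn (g x)) ->
  inL2 mu f.
Proof.
move=> mf /inL2P[mg fing] [c c0 le]; apply/inL2P; split => //.
apply: (@le_lt_trans _ _ (\int[mu]_x (c * sqn (g x))%:E)%E).
  apply: ge0_le_integral => //.
  - by move=> x _; rewrite lee_fin sqn_ge0.
  - exact: emeasurable_sqn.
  - exact: emeasurable_sqnZ.
  - by move=> x _; rewrite lee_fin.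
under eq_integral do rewrite EFinM.
rewrite ge0_integralZl//=.
- by rewrite lte_mul_pinfty.
- exact: emeasurable_sqn.
- by move=> x _; rewrite lee_fin sqn_ge0.
Qed.

Lemma inL2_sqn_integrable f : inL2 mu f ->
  mu.-integrable [set: T] (fun x => (sqn (f x))%:E).
Proof.
move=> /inL2P[mf fin]; apply/integrableP; split.
  exact: emeasurable_sqn.
by under eq_integral do rewrite gee0_abs ?lee_fin ?sqn_ge0//.
Qed.

Lemma inL2D f g : inL2 mu f -> inL2 mu g -> inL2 mu (fun x => f x + g x).
Proof.
move=> Lf Lg; have [mf ff] := (inL2P _).1 Lf; have [mg fg] := (inL2P _).1 Lg.
apply/inL2P; split; first exact: cmeasurableD.
apply: (@le_lt_trans _ _ (\int[mu]_x (2 * sqn (f x) + 2 * sqn (g x))%:E)%E).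
  apply: ge0_le_integral => //.
  - by move=> x _; rewrite lee_fin sqn_ge0.
  - by apply: emeasurable_sqn; exact: cmeasurableD.
  - by apply/measurable_EFinP/measurable_funD; apply/measurable_EFinP;
      exact: emeasurable_sqnZ.
  - by move=> x _; rewrite lee_fin sqnD_le.
under eq_integral do rewrite EFinD !EFinM.
rewrite ge0_integralD//=.
- rewrite !ge0_integralZl//=; first by rewrite lte_add_pinfty// lte_mul_pinfty.
  + exact: emeasurable_sqn.
  + by move=> x _; rewrite lee_fin sqn_ge0.
  + exact: emeasurable_sqn.
  + by move=> x _; rewrite lee_fin sqn_ge0.
- by move=> x _; rewrite -EFinM lee_fin mulr_ge0// sqn_ge0.
- exact: emeasurable_sqnZ.
- by move=> x _; rewrite -EFinM lee_fin mulr_ge0// sqn_ge0.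
- exact: emeasurable_sqnZ.
Qed.

Lemma inL2M f g c : cmeasurable f -> (forall x, sqn (f x) <= c) ->
  inL2 mu g -> inL2 mu (fun x => f x * g x).
Proof.
move=> mf fc Lg; have [mg fg] := (inL2P _).1 Lg.
apply: (inL2_le (g := g)) => //; first exact: cmeasurableM.
exists `|c| => // x; rewrite sqnM ler_wpM2r ?sqn_ge0//.
by rewrite (le_trans (fc x))// ler_norm.
Qed.

Lemma inL2Z f (c : C) : inL2 mu f -> inL2 mu (fun x => c * f x).
Proof. by apply: (inL2M (c := sqn c)) => //; exact: cmeasurable_cst. Qed.

Lemma inL2_0 : inL2 mu (fun=> 0).
Proof.
apply/inL2P; split; first exact: cmeasurable_cst.
by under eq_integral do rewrite sqn0; rewrite integral0.
Qed.

Lemma inL2N f : inL2 mu f -> inL2 mu (fun x => - f x).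
Proof. by move=> /(inL2Z (-1)); under eq_fun do rewrite mulN1r. Qed.

(** Square-integrable functions themselves, not classes modulo null sets: equality is pointwise, and
    the inner product is only semidefinite. Bundling them gives a module over the complex numbers,
    to which the abstract arguments on contractions apply. *)
Record L2 := MkL2 { L2fun :> T -> C ; L2P : inL2 mu L2fun }.

HB.instance Definition _ := gen_eqMixin L2.
HB.instance Definition _ := gen_choiceMixin L2.

Lemma L2_ext (f g : L2) : (forall x, f x = g x) -> f = g.
Proof.
case: f g => [f Lf] [g Lg] /= fg; have {}fg : f = g by exact/funext.
by move: Lf; rewrite fg => Lf; congr MkL2; exact: Prop_irrelevance.
Qed.

Definition L2add (f g : L2) := MkL2 (inL2D (L2P f) (L2P g)).
Definition L2opp (f : L2) := MkL2 (inL2N (L2P f)).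
Definition L2scale (c : C) (f : L2) := MkL2 (inL2Z c (L2P f)).

Fact L2addA : associative L2add.
Proof. by move=> f g h; apply: L2_ext => x /=; rewrite addrA. Qed.
Fact L2addC : commutative L2add.
Proof. by move=> f g; apply: L2_ext => x /=; rewrite addrC. Qed.
Fact L2add0 : left_id (MkL2 inL2_0) L2add.
Proof. by move=> f; apply: L2_ext => x /=; rewrite add0r. Qed.
Fact L2addN : left_inverse (MkL2 inL2_0) L2opp L2add.
Proof. by move=> f; apply: L2_ext => x /=; rewrite addNr. Qed.

HB.instance Definition _ :=
  GRing.isZmodule.Build L2 L2addA L2addC L2add0 L2addN.

Fact L2scaleA (a b : C) (f : L2) :
  L2scale a (L2scale b f) = L2scale (a * b) f.
Proof. by apply: L2_ext => x /=; rewrite mulrA. Qed.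
Fact L2scale1 : left_id 1 L2scale.
Proof. by move=> f; apply: L2_ext => x /=; rewrite mul1r. Qed.
Fact L2scaleDr : right_distributive L2scale +%R.
Proof. by move=> a f g; apply: L2_ext => x /=; rewrite mulrDr. Qed.
Fact L2scaleDl (f : L2) : {morph L2scale^~ f : a b / a + b}.
Proof. by move=> a b; apply: L2_ext => x /=; rewrite mulrDl. Qed.

HB.instance Definition _ := GRing.Zmodule_isLmodule.Build C L2
  L2scaleA L2scale1 L2scaleDr L2scaleDl.

Lemma L2DE (f g : L2) x : (f + g) x = f x + g x. Proof. by []. Qed.
Lemma L2BE (f g : L2) x : (f - g) x = f x - g x. Proof. by []. Qed.
Lemma L2ZE c (f : L2) x : (c *: f) x = c * f x. Proof. by []. Qed.
Lemma L2sumE I (r : seq I) (P : pred I) (F : I -> L2) x :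
  (\sum_(i <- r | P i) F i) x = \sum_(i <- r | P i) F i x.
Proof. by apply: (big_morph (fun f : L2 => f x)). Qed.

Definition dot (f g : L2) : C := inner mu f g.

Lemma integrable_inner f g : inL2 mu f -> inL2 mu g ->
  mu.-integrable [set: T] (EFin \o (fun x => complex.Re (f x * (g x)^*%C))) /\
  mu.-integrable [set: T] (EFin \o (fun x => complex.Im (f x * (g x)^*%C))).
Proof.
move=> Lf Lg.
have [mf ff] := (inL2P _).1 Lf; have [mg fg] := (inL2P _).1 Lg.
have [mr mi] := cmeasurableM mf (cmeasurableJ mg).
have ifg : mu.-integrable [set: T] (fun x => (sqn (f x) + sqn (g x))%:E).
  under eq_fun do rewrite EFinD.
  by apply: integrableD => //; exact: inL2_sqn_integrable.
split; apply: le_integrable ifg => //; try exact/measurable_EFinP.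
  move=> x _; rewrite /comp !abse_EFin lee_fin.
  apply: le_trans (ler_norm _); exact: Re_mulJ_le.
move=> x _; rewrite /comp !abse_EFin lee_fin.
by apply: le_trans (ler_norm _); exact: Im_mulJ_le.
Qed.

Lemma dotDl (f g h : L2) : dot (f + g) h = dot f h + dot g h.
Proof.
have [f1 f2] := integrable_inner (L2P f) (L2P h).
have [g1 g2] := integrable_inner (L2P g) (L2P h).
apply: eqc.
  rewrite cReD /= -RintegralD//.
  by apply: eq_Rintegral => x _; rewrite mulrDl cReD.
rewrite cImD /= -RintegralD//.
by apply: eq_Rintegral => x _; rewrite mulrDl cImD.
Qed.

Lemma dotZl c (f g : L2) : dot (c *: f) g = c * dot f g.
Proof.
have [f1 f2] := integrable_inner (L2P f) (L2P g).
have iZ (r : R) (h : T -> R) : mu.-integrable [set: T] (EFin \o h) ->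
    mu.-integrable [set: T] (EFin \o (fun x => r * h x)).
  by move=> ih; apply: (@integrableZl _ _ _ mu _ measurableT r _ ih).
apply: eqc.
  rewrite cReM /= -!RintegralZl// -RintegralB//; [|exact: iZ..].
  by apply: eq_Rintegral => x _; rewrite -mulrA cReM.
rewrite cImM /= -!RintegralZl// -RintegralD//; [|exact: iZ..].
by apply: eq_Rintegral => x _; rewrite -mulrA cImM.
Qed.

Lemma dotC (f g : L2) : dot g f = (dot f g)^*%C.
Proof.
have [f1 f2] := integrable_inner (L2P f) (L2P g).
apply: eqc; rewrite ?cReJ ?cImJ /=.
  by apply: eq_Rintegral => x _; rewrite !cReM !cReJ !cImJ; ring.
rewrite -[RHS]mulN1r -RintegralZl//.
by apply: eq_Rintegral => x _; rewrite !cImM !cReJ !cImJ; ring.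
Qed.

Lemma dotff (f : L2) : dot f f = (fine (\int[mu]_x (sqn (f x))%:E))%:C%C.
Proof.
apply: eqc => /=.
  by congr fine; apply: eq_integral => x _; rewrite mulcJ.
transitivity (\int[mu]_x (0 : R))%R; last by rewrite Rintegral_cst// mul0r.
by apply: eq_Rintegral => x _; rewrite mulcJ.
Qed.

End L2_space.

(** * Contractions of a pre-Hilbert space *)

Section prehilbert.
Context {R : realType} {V : lmodType R[i]}.
Local Notation C := R[i].

(** Semidefinite, since a nonzero function vanishing almost everywhere has norm 0. *)
Definition pos_hermitian (dot : V -> V -> C) : Prop :=
  [/\ forall f g h, dot (f + g) h = dot f h + dot g h,
      forall c f g, dot (c *: f) g = c * dot f g,
      forall f g, dot g f = (dot f g)^*%C &
      forall f, exists2 r : R, 0 <= r & dot f f = r%:C%C].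

Variable dot : V -> V -> C.
Hypothesis hdot : pos_hermitian dot.

Definition nrm2 (f : V) : R := complex.Re (dot f f).

Lemma hdotDl f g h : dot (f + g) h = dot f h + dot g h.
Proof. by case: hdot => ->. Qed.

Lemma hdotZl c f g : dot (c *: f) g = c * dot f g.
Proof. by case: hdot => _ ->. Qed.

Lemma hdotC f g : dot g f = (dot f g)^*%C.
Proof. by case: hdot => _ _ ->. Qed.

Lemma hdotff f : dot f f = (nrm2 f)%:C%C.
Proof. by rewrite /nrm2; case: hdot => _ _ _ /(_ f)[r _ ->]. Qed.

Lemma nrm2_ge0 f : 0 <= nrm2 f.
Proof. by rewrite /nrm2; case: hdot => _ _ _ /(_ f)[r r0 ->]. Qed.

Lemma hdotDr f g h : dot f (g + h) = dot f g + dot f h.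
Proof. by rewrite hdotC hdotDl rmorphD /= -!hdotC. Qed.

Lemma hdotZr c f g : dot f (c *: g) = c^*%C * dot f g.
Proof. by rewrite hdotC hdotZl rmorphM /= -hdotC. Qed.

Lemma hdotNl f g : dot (- f) g = - dot f g.
Proof. by rewrite -scaleN1r hdotZl mulN1r. Qed.

Lemma hdotNr f g : dot f (- g) = - dot f g.
Proof. by rewrite hdotC hdotNl rmorphN /= -hdotC. Qed.

Lemma hdotBl f g h : dot (f - g) h = dot f h - dot g h.
Proof. by rewrite hdotDl hdotNl. Qed.

Lemma hdotBr f g h : dot f (g - h) = dot f g - dot f h.
Proof. by rewrite hdotDr hdotNr. Qed.

Lemma hdot0l f : dot 0 f = 0.
Proof. by rewrite -(scale0r 0) hdotZl mul0r. Qed.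

Lemma hdot0r f : dot f 0 = 0.
Proof. by rewrite hdotC hdot0l rmorph0. Qed.

Lemma hdot_suml I (r : seq I) (P : pred I) (F : I -> V) g :
  dot (\sum_(i <- r | P i) F i) g = \sum_(i <- r | P i) dot (F i) g.
Proof.
by apply: (big_morph (dot^~ g)) => [f h|]; rewrite ?hdotDl ?hdot0l.
Qed.

Lemma hdot_sumr I (r : seq I) (P : pred I) (F : I -> V) g :
  dot g (\sum_(i <- r | P i) F i) = \sum_(i <- r | P i) dot g (F i).
Proof.
by apply: (big_morph (dot g)) => [f h|]; rewrite ?hdotDr ?hdot0r.
Qed.

Lemma nrm2D f g : nrm2 (f + g) = nrm2 f + nrm2 g + 2 * complex.Re (dot f g).
Proof.
rewrite /nrm2 hdotDl !hdotDr !cReD (hdotC f g) cReJ; ring.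
Qed.

Lemma nrm2N f : nrm2 (- f) = nrm2 f.
Proof. by rewrite /nrm2 hdotNl hdotNr opprK. Qed.

Lemma nrm2B f g : nrm2 (f - g) = nrm2 f + nrm2 g - 2 * complex.Re (dot f g).
Proof. by rewrite nrm2D nrm2N hdotNr raddfN /= mulrN. Qed.

Lemma nrm20 : nrm2 0 = 0.
Proof. by rewrite /nrm2 hdot0l. Qed.

Lemma nrm2Z c f : nrm2 (c *: f) = sqn c * nrm2 f.
Proof.
rewrite /nrm2 hdotZl hdotZr mulrA mulcJ (hdotff f) cReM /=; ring.
Qed.

Lemma nrm2D_le f g : nrm2 (f + g) <= 2 * nrm2 f + 2 * nrm2 g.
Proof. by have := nrm2_ge0 (f - g); rewrite nrm2B nrm2D; lra. Qed.

Lemma cauchy_schwarz f g : sqn (dot f g) <= nrm2 f * nrm2 g.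
Proof.
(* This is the squared norm of f - t <f, g> g. The choice t = 1 / |g|^2 gives the inequality; when
   |g| = 0, a large t excludes <f, g> != 0. *)
have H (t : R) : 0 <= nrm2 f + t ^+ 2 * sqn (dot f g) * nrm2 g
    - 2 * t * sqn (dot f g).
  apply: le_trans (nrm2_ge0 (f - (t%:C%C * dot f g) *: g)) _.
  rewrite nrm2B nrm2Z sqnM sqnR hdotZr.
  have -> : (t%:C%C * dot f g)^*%C = t%:C%C * (dot f g)^*%C.
    by rewrite rmorphM /= oppr0.
  rewrite -[t%:C%C * _ * _]mulrA mulJc cReM /=; lra.
have [g0|g0] := eqVneq (nrm2 g) 0.
  have [d0|d0] := eqVneq (sqn (dot f g)) 0; first by rewrite d0 g0 mulr0.
  have := H ((nrm2 f + 1) / sqn (dot f g)); rewrite g0 mulr0 addr0.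
  rewrite -[2 * _ * _]mulrA divfK// => h.
  by exfalso; have := nrm2_ge0 f; lra.
have gp : 0 < nrm2 g by rewrite lt_neqAle eq_sym g0 nrm2_ge0.
have := H (nrm2 g)^-1; rewrite -(pmulr_rge0 _ gp) => h.
have : 0 <= nrm2 f * nrm2 g - sqn (dot f g).
  apply: le_trans h _; rewrite le_eqVlt; apply/orP; left; apply/eqP.
  by field.
by rewrite subr_ge0.
Qed.

Lemma nrm2_orthonormal_sum (u : nat -> V) (c : nat -> C) N :
  (forall i j, dot (u i) (u j) = (i == j)%:R) ->
  nrm2 (\sum_(k < N) c k *: u k) = \sum_(k < N) sqn (c k).
Proof.
move=> ou; elim: N => [|N IH]; first by rewrite !big_ord0 nrm20.
rewrite !big_ord_recr /= nrm2D IH nrm2Z /nrm2 ou eqxx /= mulr1.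
suff -> : dot (\sum_(k < N) c k *: u k) (c N *: u N) = 0 by rewrite mulr0 addr0.
rewrite hdot_suml big1// => i _.
by rewrite hdotZl hdotZr ou ltn_eqF// !mulr0.
Qed.

End prehilbert.

(** * Vectors on which the powers of a contraction tend to 0 *)

Section stable.
Context {R : realType} {V : lmodType R[i]} (dot : V -> V -> R[i]).
Hypothesis hdot : pos_hermitian dot.
Variable A : V -> V.
Hypothesis Alin : forall c f g, A (c *: f + g) = c *: A f + A g.
Hypothesis Acontr : forall f, nrm2 dot (A f) <= nrm2 dot f.
Local Notation nrm2 := (nrm2 dot).

(** For a contraction one small iterate makes all later ones small, so this is convergence of A^N f
    to 0, in a form that passes easily to limits of vectors. *)
Definition stable (f : V) : Prop :=
  forall eps : R, 0 < eps -> exists N, nrm2 (iter N A f) <= eps.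

Lemma iter_lin N c f g : iter N A (c *: f + g) = c *: iter N A f + iter N A g.
Proof. by elim: N => //= N ->; rewrite Alin. Qed.

Lemma iterD_lin N f g : iter N A (f + g) = iter N A f + iter N A g.
Proof. by have := iter_lin N 1 f g; rewrite !scale1r. Qed.

Lemma iter0_lin N : iter N A 0 = 0.
Proof.
have := iterD_lin N 0 0; rewrite addr0 => h.
by apply: (addrI (iter N A 0)); rewrite -h addr0.
Qed.

Lemma iterZ_lin N c f : iter N A (c *: f) = c *: iter N A f.
Proof. by rewrite -[c *: f in LHS]addr0 iter_lin iter0_lin addr0. Qed.

Lemma iter_contr N M f : (N <= M)%N -> nrm2 (iter M A f) <= nrm2 (iter N A f).
Proof.
move=> /subnK <-; rewrite iterD; elim: (M - N)%N => //= k IH.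
exact: le_trans (Acontr _) IH.
Qed.

Lemma stable_ge f (eps : R) : stable f -> 0 < eps ->
  exists N, forall M, (N <= M)%N -> nrm2 (iter M A f) <= eps.
Proof.
move=> sf e0; have [N hN] := sf _ e0; exists N => M NM.
exact: le_trans (iter_contr f NM) hN.
Qed.

Lemma stable0 : stable 0.
Proof. by move=> e e0; exists 0%N; rewrite /= nrm20// ltW. Qed.

Lemma stableD f g : stable f -> stable g -> stable (f + g).
Proof.
move=> sf sg e e0; have e40 : 0 < e / 4 by lra.
have [N hN] := stable_ge sf e40; have [M hM] := stable_ge sg e40.
exists (maxn N M); rewrite iterD_lin; apply: le_trans (nrm2D_le hdot _ _) _.
have := hN _ (leq_maxl N M); have := hM _ (leq_maxr N M); lra.
Qed.

Lemma stableZ c f : stable f -> stable (c *: f).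
Proof.
move=> sf e e0; have c0 : 0 < 1 + sqn c by have := sqn_ge0 c; lra.
have [N hN] := sf _ (divr_gt0 e0 c0); exists N.
rewrite iterZ_lin nrm2Z//; apply: (@le_trans _ _ ((1 + sqn c) * (e / (1 + sqn c)))).
  by apply: ler_pM => //; [exact: sqn_ge0|exact: nrm2_ge0|rewrite lerDr].
by rewrite mulrC divfK// gt_eqF.
Qed.

Lemma stable_sum I (r : seq I) (P : pred I) (F : I -> V) :
  (forall i, P i -> stable (F i)) -> stable (\sum_(i <- r | P i) F i).
Proof.
move=> sF; elim/big_rec: _ => [|i f Pi sf]; first exact: stable0.
by apply: stableD => //; exact: sF.
Qed.

Lemma stable_closed f :
  (forall eps : R, 0 < eps -> exists2 g, stable g & nrm2 (f - g) <= eps) ->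
  stable f.
Proof.
move=> H e e0; have e40 : 0 < e / 4 by lra.
have [g sg fg] := H _ e40; have [N hN] := sg _ e40; exists N.
have -> : f = (f - g) + g by rewrite subrK.
rewrite iterD_lin; apply: le_trans (nrm2D_le hdot _ _) _.
by have := iter_contr (f - g) (leq0n N); rewrite /=; lra.
Qed.

Lemma stable_preimage f : stable (A f) -> stable f.
Proof. by move=> sf e e0; have [N hN] := sf _ e0; exists N.+1; rewrite iterSr. Qed.

Lemma stable_image f : stable f -> stable (A f).
Proof.
move=> sf e e0; have [N hN] := sf _ e0; exists N; rewrite -iterSr.
exact: le_trans (iter_contr f (leqnSn N)) hN.
Qed.

End stable.

Section L2_hermitian.
Context {d} {T : measurableType d} {R : realType}.
Variable mu : {measure set T -> \bar R}.

Lemma L2_pos_hermitian : pos_hermitian (@dot d T R mu).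
Proof.
split; [exact: dotDl|exact: dotZl|exact: dotC|].
move=> f; exists (fine (\int[mu]_x (sqn (f x))%:E)%E); last exact: dotff.
by rewrite fine_ge0// int_sqn_ge0.
Qed.

Lemma nrm2E (f : L2 mu) :
  (nrm2 (@dot d T R mu) f)%:E = (\int[mu]_x (sqn (f x))%:E)%E.
Proof.
rewrite /nrm2 dotff /= fineK// ge0_fin_numE ?int_sqn_ge0//.
by have /inL2P[] := L2P f.
Qed.

Lemma inL2_bounded (f : T -> R[i]) (c : R) : (mu [set: T] < +oo)%E ->
  cmeasurable f -> (forall x, sqn (f x) <= c) -> inL2 mu f.
Proof.
move=> fin mf fc; apply/inL2P; split => //.
apply: (@le_lt_trans _ _ (\int[mu]_x (cst c%:E x))%E).
  apply: ge0_le_integral => //.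
  - by move=> x _; rewrite lee_fin sqn_ge0.
  - exact: emeasurable_sqn.
  - by move=> x _; rewrite lee_fin.
have finmu : mu [set: T] \is a fin_num by rewrite ge0_fin_numE.
by rewrite integral_cst// -(fineK finmu) -EFinM ltry.
Qed.

Lemma nrm2_L2norm (f : L2 mu) :
  L2norm mu f = (Num.sqrt (nrm2 (@dot d T R mu) f))%:E.
Proof.
by rewrite L2normE -nrm2E poweR_EFin powR12_sqrt// nrm2_ge0//; exact: L2_pos_hermitian.
Qed.

End L2_hermitian.

(** * The Kaczmarz operator of a singular unitary *)

(* Quantitative form of: [q s = 1] and [2 Re q = 1] imply [|1 - s| = 1]. *)
Lemma unimodular_ineq {R : realType} (q s : R[i]) (delta : R) :
  0 < delta -> delta <= 1 ->
  1 <= sqn (1 - s) + 16 * (delta + (sqn (q * s - 1)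
                       + (2 * complex.Re q - 1) ^+ 2) / delta).
Proof.
move=> d0 d1; set e2 := 2 * complex.Re q - 1; set e1 := q * s - 1.
set k := delta^-1; have k0 : 0 < k by rewrite invr_gt0.
have dk : delta * k = 1 by rewrite divff// gt_eqF.
have k1 : 1 <= k by rewrite -(invr1 R) lef_pV2 ?posrE.
have s1 := sqn_ge0 (1 - s); have se1 := sqn_ge0 e1.
have e20 := sqr_ge0 e2.
(* If e2^2 >= 1/4, the error term 16 e2^2 / delta already exceeds 1. Otherwise Re q >= 1/4, hence
   |q|^2 >= 1/16: this is the origin of the factor 16. *)
have [he|he] := lerP (1 / 4) (e2 ^+ 2).
  have h1 : 1 / 4 <= e2 ^+ 2 * k.
    by apply: le_trans he _; rewrite ler_peMr.
  have h2 : 0 <= sqn e1 * k by rewrite mulr_ge0// ltW.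
  rewrite mulrDl; lra.
have e2l : - (1 / 2) <= e2 by nra.
have n16 : 1 / 16 <= sqn q.
  apply: le_trans (Re_sq_le q); have -> : complex.Re q = (1 + e2) / 2.
    by rewrite /e2; field.
  nra.
have hn : sqn (q - 1) = sqn q - e2.
  by rewrite /sqn /e2; case: (q) => a b /=; ring.
(* Weighted triangle inequality: the cross term is split as delta |x|^2 + |y|^2 / delta. It is
   applied to q (1 - s) = (q - 1) - e1, where |q - 1|^2 = |q|^2 - e2. *)
have hl (x y : R[i]) : (1 - delta) * sqn x - k * sqn y <= sqn (x - y).
  case: x y => [a b] [c e]; rewrite /sqn /=.
  have aux (u v : R) : (1 - delta) * u ^+ 2 - k * v ^+ 2 <= (u - v) ^+ 2.
    have : 0 <= k * (delta * u - v) ^+ 2 by rewrite mulr_ge0 ?sqr_ge0 ?ltW.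
    have -> : k * (delta * u - v) ^+ 2 =
        (delta * k) * delta * u ^+ 2 - 2 * (delta * k) * u * v + k * v ^+ 2.
      by ring.
    by rewrite dk; nra.
  have := aux a c; have := aux b e; lra.
have hq : sqn q * sqn (1 - s) = sqn (q - 1 - e1).
  by rewrite -sqnM; congr sqn; rewrite /e1; ring.
have h1 : sqn q * (1 - sqn (1 - s)) <=
    delta * sqn q + (1 - delta) * e2 + k * sqn e1.
  by rewrite mulrBr mulr1 hq; have := hl (q - 1) e1; rewrite hn; lra.
have h2 : (1 - delta) * e2 <= (delta + k * e2 ^+ 2) / 2.
  have [e2n|e2p] := lerP e2 0.
    apply: (@le_trans _ _ 0); first by rewrite mulr_ge0_le0// subr_ge0.
    by have := mulr_ge0 (ltW k0) e20; lra.
  have h : e2 <= (delta + k * e2 ^+ 2) / 2.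
    have : 0 <= k * (delta - e2) ^+ 2 by rewrite mulr_ge0 ?sqr_ge0 ?ltW.
    have -> : k * (delta - e2) ^+ 2 =
        (delta * k) * delta - 2 * (delta * k) * e2 + k * e2 ^+ 2 by ring.
    by rewrite dk; lra.
  by apply: le_trans h; rewrite ler_piMl ?(ltW e2p)//; lra.
have nq : 0 < sqn q by lra.
rewrite -lerBlDl -(ler_pM2l nq); apply: le_trans h1 _.
have h3 : delta / 2 + k * e2 ^+ 2 / 2 + k * sqn e1 <=
    sqn q * (8 * delta + 16 * (k * e2 ^+ 2) + 16 * (k * sqn e1)).
  have a1 : 0 <= k * e2 ^+ 2 by rewrite mulr_ge0// ltW.
  have a2 : 0 <= k * sqn e1 by rewrite mulr_ge0// ltW.
  apply: (@le_trans _ _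
      (1 / 16 * (8 * delta + 16 * (k * e2 ^+ 2) + 16 * (k * sqn e1)))).
    by lra.
  by rewrite ler_wpM2r//; lra.
have h4 : 0 <= sqn q * (7 * delta) by rewrite !mulr_ge0// ltW.
move: h2 h3 h4; rewrite -/k; lra.
Qed.

Section laurent.
Context {R : realType}.
Local Notation C := R[i].

(** A list of pairs (coefficient, exponent) in which exponents may repeat, so that adding
    polynomials is concatenation. *)
Definition laurent (P : seq (C * int)) (z : C) : C :=
  \sum_(t <- P) t.1 * z ^ t.2.

Lemma unit_neq0 (z : C) : sqn z = 1 -> z != 0.
Proof. by apply: contra_eq_neq => ->; rewrite sqn0 eq_sym oner_neq0. Qed.

Lemma unit_exprzJ (z : C) (l : int) : sqn z = 1 -> (z ^ l)^*%C = z ^ (- l).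
Proof.
move=> z1; rewrite -exprz_inv sqn1_inv//.
by case: l => n; rewrite ?NegzE -?exprnN -?exprnP ?rmorphV ?unitfE ?expf_neq0 ?unit_neq0 ?rmorphXn.
Qed.

Lemma unit_exprzS (z : C) (l : int) : sqn z = 1 -> z ^ (l + 1) = z * z ^ l.
Proof. by move=> z1; rewrite addrC expfzDr ?unit_neq0// expr1z. Qed.

Lemma sqn_exprz (z : C) (l : int) : sqn z = 1 -> sqn (z ^ l) = 1.
Proof.
by move=> z1; apply: complexI; rewrite -mulcJ unit_exprzJ// -expfzDr ?unit_neq0// subrr.
Qed.

Lemma Re_half (a x : C) : complex.Re (a / 2 * x) = complex.Re (a * x) / 2.
Proof.
have -> : (2 : C)^-1 = (2^-1 : R)%:C%C by rewrite fmorphV rmorph_nat.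
by case: a x => [a b] [c d] /=; field.
Qed.

Lemma laurent_cat P Q (z : C) : laurent (P ++ Q) z = laurent P z + laurent Q z.
Proof. by rewrite /laurent big_cat. Qed.

Lemma exprz_cmeasurable d (T : measurableType d) (z : T -> C) (l : int) :
  cmeasurable z -> (forall x, sqn (z x) = 1) -> cmeasurable (fun x => z x ^ l).
Proof.
move=> zm z1; case: l => n; first exact: cmeasurableX.
under eq_fun => x do rewrite NegzE -unit_exprzJ//.
by apply: cmeasurableJ; exact: cmeasurableX.
Qed.

Lemma laurent_cmeasurable d (T : measurableType d) (z : T -> C) P :
  cmeasurable z -> (forall x, sqn (z x) = 1) ->
  cmeasurable (fun x => laurent P (z x)).
Proof.
move=> zm z1; elim: P => [|t P IH].
  by under eq_fun do rewrite /laurent big_nil; exact: cmeasurable_cst.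
under eq_fun do rewrite /laurent big_cons -/(laurent P _).
apply: cmeasurableD => //; apply: cmeasurableM; first exact: cmeasurable_cst.
exact: exprz_cmeasurable.
Qed.

End laurent.

Lemma integral_addZ_le d (T : measurableType d) (R : realType)
    (mu : {measure set T -> \bar R}) (f g : T -> R) (c a b : R) :
  measurable_fun [set: T] f -> measurable_fun [set: T] g ->
  (forall x, 0 <= f x) -> (forall x, 0 <= g x) -> 0 <= c ->
  (\int[mu]_x (f x)%:E <= a%:E)%E -> (\int[mu]_x (g x)%:E <= b%:E)%E ->
  (\int[mu]_x (f x + c * g x)%:E <= (a + c * b)%:E)%E.
Proof.
move=> mf mg f0 g0 c0 fa gb.
have mg' : measurable_fun [set: T] (fun x => (g x)%:E) by exact/measurable_EFinP.
have gE0 x : [set: T] x -> (0 <= (g x)%:E)%E by rewrite lee_fin.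
under eq_integral do rewrite EFinD EFinM.
rewrite ge0_integralD//.
- by rewrite ge0_integralZl// EFinD EFinM leeD// lee_wpmul2l// lee_fin.
- by move=> x _; rewrite lee_fin.
- exact/measurable_EFinP.
- by move=> x _; rewrite -EFinM lee_fin mulr_ge0.
- by apply/measurable_EFinP/measurable_funM.
Qed.

Lemma cvg0_lin {R : realType} (a b : R) (u v : nat -> R) :
  u @ \oo --> (0 : R) -> v @ \oo --> (0 : R) ->
  (fun N => a * u N + b * v N) @ \oo --> (0 : R).
Proof.
move=> u0 v0; rewrite [X in _ --> X](_ : 0 = a * 0 + b * 0); last by ring.
by apply: cvgD; apply: cvgMr.
Qed.

(** Parseval on the circle: orthonormality of the powers of the unimodular [w] says that [w]
    transports [lam] to the Haar measure. *)
Lemma mean_power_sum d (T : measurableType d) (R : realType)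
    (lam : {measure set T -> \bar R}) (w : T -> R[i]) (c : nat -> R[i]) N :
  cmeasurable w -> (forall x, sqn (w x) = 1) -> lam [set: T] = 1%E ->
  (forall i j : nat,
    inner lam (fun x => w x ^+ i) (fun x => w x ^+ j) = (i == j)%:R) ->
  (\int[lam]_x (sqn (\sum_(k < N) c k * w x ^+ k))%:E =
    (\sum_(k < N) sqn (c k))%:E)%E.
Proof.
move=> wm w1 lam1 worth.
have wX k : inL2 lam (fun x => w x ^+ k).
  apply: (@inL2_bounded _ _ _ lam _ 1); rewrite ?lam1 ?ltry//.
    exact: cmeasurableX.
  by move=> x; rewrite sqnX w1 expr1n.
pose F k := MkL2 (wX k).
rewrite -(nrm2_orthonormal_sum (L2_pos_hermitian lam) (u := F))//.
rewrite nrm2E; apply: eq_integral => x _; rewrite L2sumE.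
by congr (sqn _)%:E; apply: eq_bigr.
Qed.

Section kaczmarz.
Context {R : realType} {V : lmodType R[i]} (dot : V -> V -> R[i]).
Local Notation C := R[i].
Hypothesis hdot : pos_hermitian dot.
Local Notation nrm2 := (nrm2 dot).
Variables (e : V) (U' : V -> V).
Hypothesis e1 : dot e e = 1.
Hypothesis U'lin : forall c f g, U' (c *: f + g) = c *: U' f + U' g.
Hypothesis U'iso : forall f, nrm2 (U' f) = nrm2 f.

(** [U'] stands for the inverse of the unitary U. *)
Definition kacz (f : V) : V := U' (f - dot f e *: e).

Lemma kacz_lin c f g : kacz (c *: f + g) = c *: kacz f + kacz g.
Proof.
rewrite /kacz -U'lin (hdotDl hdot)// (hdotZl hdot)//; congr U'.
by rewrite scalerDl -scalerA scalerBr opprD addrACA.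
Qed.

Lemma nrm2_kacz f : nrm2 (kacz f) = nrm2 f - sqn (dot f e).
Proof.
rewrite U'iso (nrm2B hdot)// (nrm2Z hdot)// (hdotZr hdot)// mulJc /nrm2 e1 /=; lra.
Qed.

Lemma kacz_contr f : nrm2 (kacz f) <= nrm2 f.
Proof. by rewrite nrm2_kacz gerBl sqn_ge0. Qed.

Definition coef (f : V) (k : nat) : C := dot (iter k kacz f) e.

Lemma coef_lin c f g k : coef (c *: f + g) k = c * coef f k + coef g k.
Proof. by rewrite /coef (iter_lin kacz_lin) (hdotDl hdot) (hdotZl hdot). Qed.

Lemma coefD f g k : coef (f + g) k = coef f k + coef g k.
Proof. by have := coef_lin 1 f g k; rewrite scale1r mul1r. Qed.

Lemma coefZ c f k : coef (c *: f) k = c * coef f k.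
Proof. by rewrite /coef (iterZ_lin kacz_lin) (hdotZl hdot). Qed.

Lemma coefS f k : coef f k.+1 = coef (kacz f) k.
Proof. by rewrite /coef iterSr. Qed.

Lemma nrm2_iter_kacz f N :
  nrm2 f = nrm2 (iter N kacz f) + \sum_(k < N) sqn (coef f k).
Proof.
elim: N => [|N IH]; first by rewrite big_ord0 addr0.
by rewrite big_ord_recr /= nrm2_kacz IH /coef; lra.
Qed.

Lemma sum_coef_le f N : \sum_(k < N) sqn (coef f k) <= nrm2 f.
Proof. by rewrite (nrm2_iter_kacz f N) lerDr nrm2_ge0. Qed.

(** The squared coefficients have sum at most |f|^2. This decay makes truncation of the series
    harmless. *)
Lemma coef_cvg0 f : (fun k => sqn (coef f k)) @ \oo --> (0 : R).
Proof.
apply: cvg_series_cvg_0; apply: nondecreasing_is_cvgn.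
  by apply: nondecreasing_series => k _ _; exact: sqn_ge0.
exists (nrm2 f) => _ [N _ <-].
by rewrite seriesEord sum_coef_le.
Qed.

Lemma kacz_e : kacz e = 0.
Proof.
rewrite /kacz e1 scale1r subrr.
by have := U'lin (-1) 0 0; rewrite scaler0 addr0 scaleN1r addNr.
Qed.

Lemma coef_e0 : coef e 0 = 1. Proof. exact: e1. Qed.

Lemma coef_eS k : coef e k.+1 = 0.
Proof. by rewrite coefS kacz_e /coef (iter0_lin kacz_lin) (hdot0l hdot). Qed.

(** The N-th section of the normalised Cauchy transform of f with respect to the spectral measure of
    [e]. *)
Definition psum (f : V) (N : nat) (w : C) : C := \sum_(k < N) coef f k * w ^+ k.

Lemma psumD f g N w : psum (f + g) N w = psum f N w + psum g N w.
Proof.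
by rewrite /psum -big_split; apply: eq_bigr => k _; rewrite coefD mulrDl.
Qed.

Lemma psumZ c f N w : psum (c *: f) N w = c * psum f N w.
Proof.
by rewrite /psum mulr_sumr; apply: eq_bigr => k _; rewrite coefZ mulrA.
Qed.

Lemma psumB f g N w : psum (f - g) N w = psum f N w - psum g N w.
Proof. by rewrite psumD -scaleN1r psumZ mulN1r. Qed.

Lemma psum0 N w : psum 0 N w = 0.
Proof. by rewrite -(scale0r (0 : V)) psumZ mul0r. Qed.

Lemma psumS f N w : psum f N.+1 w = psum f N w + coef f N * w ^+ N.
Proof. by rewrite /psum big_ord_recr. Qed.

Lemma psumSl f N w : psum f N.+1 w = coef f 0 + w * psum (kacz f) N w.
Proof.
rewrite /psum big_ord_recl /= mulr1 mulr_sumr; congr (_ + _).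
by apply: eq_bigr => k _; rewrite coefS exprS mulrCA.
Qed.

Lemma psum_eS N w : psum e N.+1 w = 1.
Proof.
rewrite /psum big_ord_recl /= coef_e0 mulr1 big1 ?addr0// => k _.
by rewrite coef_eS mul0r.
Qed.

Variable v : int -> V.
Hypothesis v0 : v 0 = e.
Hypothesis vS : forall l, U' (v (l + 1)) = v l.

Local Notation hat l := (dot (v l) e).
Hypothesis hatN : forall l, hat (- l) = (hat l)^*%C.

(** Up to a multiple of U^-1 e, the operator moves U^(l+1) e to U^l e; hence the behaviour at
    [v (-1)] decides about every [v l]. *)
Lemma kacz_v l : kacz (v (l + 1)) = v l - hat (l + 1) *: v (-1).
Proof.
have U'e : U' e = v (-1) by rewrite -(vS (-1)) addNr v0.
rewrite /kacz -scaleNr addrC U'lin U'e vS addrC scaleNr.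
by [].
Qed.

(* [ser N w] is the N-th section of the power series of 1 - theta, where theta
   is the inner function whose Clark measure is the spectral measure of [e]. *)
Definition ser N w : C := 1 - w * psum (v (-1)) N w.

Lemma psum_v l N w : psum (v (l + 1)) N.+1 w =
  w * psum (v l) N w + hat (l + 1) * ser N w.
Proof.
rewrite psumSl kacz_v psumB psumZ /ser {1}/coef /=; ring.
Qed.

(* [Qz l] is the polynomial q such that the coefficients of [v l] sum to
   [w ^ l + q * ser]. *)
Fixpoint Qp (l : nat) (w : C) : C :=
  if l is m.+1 then w * Qp m w + hat l%:Z else 0.

Fixpoint Qm (l : nat) (w : C) : C :=
  if l is m.+1 then w^*%C * (Qm m w - hat (- m%:Z)) else 0.

Definition Qz (l : int) (w : C) : C :=
  match l with Posz n => Qp n w | Negz n => Qm n.+1 w end.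

Lemma Qm_Qz (n : nat) w : Qz (- n%:Z) w = Qm n w.
Proof. by case: n => [|n]; rewrite ?oppr0// -NegzE. Qed.

Lemma QzS l w : sqn w = 1 -> Qz (l + 1) w = w * Qz l w + hat (l + 1).
Proof.
move=> w1; case: l => n; first by rewrite -PoszD addn1.
have -> : Negz n + 1 = - n%:Z by rewrite NegzE -addn1 PoszD opprD subrK.
by rewrite Qm_Qz /= mulrA mulcJ w1 mul1r subrK.
Qed.

Lemma Qz_sym_nat (n : nat) w : sqn w = 1 ->
  Qz n w + (Qz (- n%:Z) w)^*%C = hat n%:Z - w ^ n%:Z.
Proof.
move=> w1; rewrite Qm_Qz; elim: n => [|n IH].
  by rewrite [Qz _ _]/= [Qm _ _]/= conjc0 addr0 v0 e1 expr0z subrr.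
rewrite /= rmorphM /= conjcK rmorphB /= -hatN opprK.
have -> : w ^ n.+1%:Z = w * w ^ n%:Z by rewrite -unit_exprzS// -PoszD addn1.
have -> : (Qm n w)^*%C = hat n%:Z - w ^ n%:Z - Qz n w by rewrite -IH addrC addKr.
rewrite /Qz /=; ring.
Qed.

(** Origin of the formula for 2 Re q: a real polynomial pairs the exponents l and - l with conjugate
    coefficients. *)
Lemma Qz_sym l w : sqn w = 1 -> Qz l w + (Qz (- l) w)^*%C = hat l - w ^ l.
Proof.
move=> w1; case: l => n; first exact: Qz_sym_nat.
rewrite NegzE opprK hatN -unit_exprzJ//.
have := Qz_sym_nat n.+1 w1; move: (Qz _ w) (Qz _ w) (hat _) (w ^ _) => x y z t h.
by rewrite -rmorphB -h rmorphD /= conjcK addrC.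
Qed.

(** The recursion [psum_v] is exact between the sections N and N + 1. Comparing both sides at N
    leaves the error coef (v (l + 1)) N * w^N, whose modulus does not depend on w. Each step of the
    induction on l, upwards or downwards since |w| = 1, adds one such error. *)
Lemma psum_v_bound l : exists2 b : nat -> R, b @ \oo --> (0 : R) &
  forall N w, sqn w = 1 ->
    sqn (psum (v l) N w - w ^ l - Qz l w * ser N w) <= b N.
Proof.
pose err l N w := psum (v l) N w - w ^ l - Qz l w * ser N w.
have errS j N w : sqn w = 1 ->
    err (j + 1) N w = w * err j N w - coef (v (j + 1)) N * w ^+ N.
  move=> w1; have := psum_v j N w; rewrite psumS => /eqP.
  rewrite -subr_eq0 => /eqP h.
  rewrite /err unit_exprzS// QzS//; apply/eqP; rewrite -subr_eq0 -h; apply/eqP.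
  by ring.
have wX (w : C) N : sqn w = 1 -> sqn (w ^+ N) = 1.
  by move=> w1; rewrite sqnX w1 expr1n.
have cvgB (b : nat -> R) j : b @ \oo --> (0 : R) ->
    (fun N => 2 * b N + 2 * sqn (coef (v j) N)) @ \oo --> (0 : R).
  move=> b0; rewrite -[X in _ --> X](addr0 (0 : R)).
  by apply: cvgD; rewrite -[X in _ --> X](mulr0 (2 : R)); apply: cvgMr;
    [exact: b0|exact: coef_cvg0].
elim/int_ind: l => [|n [b b0 IH]|n [b b0 IH]].
(* The empty section of [e] is 0; from N = 1 on the section is exactly 1. *)
- exists (fun N => if N is 0%N then 1 else 0).
    by apply: (@cvg_near_cst _ _ _ _ _); exists 1%N => // -[].
  move=> [|N] w w1; first by rewrite /psum big_ord0 expr0z mul0r !subr0 sub0r sqnN sqn1.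
  by rewrite v0 psum_eS expr0z mul0r subr0 subrr sqn0.
- exists (fun N => 2 * b N + 2 * sqn (coef (v n.+1%:Z) N)); first exact: cvgB.
  move=> N w w1; rewrite -addn1 PoszD -/(err _ _ _) errS//.
  apply: le_trans (sqnD_le _ _) _; rewrite sqnN !sqnM wX// w1 mul1r mulr1.
  by rewrite lerD// ler_pM2l// IH.
- exists (fun N => 2 * b N + 2 * sqn (coef (v (- n%:Z)) N)); first exact: cvgB.
  move=> N w w1; rewrite -/(err _ _ _); set j := - n.+1%:Z.
  have jn : - n%:Z = j + 1 by rewrite /j -addn1 PoszD opprD subrK.
  have : sqn (w * err j N w) = sqn (err (- n%:Z) N w + coef (v (- n%:Z)) N * w ^+ N).
    by congr sqn; rewrite jn errS// subrK.
  rewrite sqnM w1 mul1r => ->; apply: le_trans (sqnD_le _ _) _.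
  by rewrite !sqnM wX// mulr1 lerD// ler_pM2l// IH.
Qed.

(** The vector (Re p)(U) e, where p is the polynomial of [P]. *)
Definition realpart (P : seq (C * int)) : V :=
  \sum_(t <- P) ((t.1 / 2) *: v t.2 + (t.1^*%C / 2) *: v (- t.2)).

Lemma psum_realpart P : exists Q : C -> C, exists2 b : nat -> R,
  b @ \oo --> (0 : R) &
  forall w, sqn w = 1 ->
    2 * complex.Re (Q w) =
      complex.Re (dot (realpart P) e) - complex.Re (laurent P w) /\
    forall N, sqn (psum (realpart P) N w - (complex.Re (laurent P w))%:C%C
                   - Q w * ser N w) <= b N.
Proof.
elim: P => [|[a l] P [Q [b b0 IH]]].
  exists (fun=> 0), (fun=> 0); first exact: cvg_cst.
  move=> w w1; rewrite /realpart /laurent !big_nil (hdot0l hdot)//= mulr0 subrr.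
  by split => // N; rewrite psum0 mul0r !subr0 sqn0.
have [b1 b10 H1] := psum_v_bound l; have [b2 b20 H2] := psum_v_bound (- l).
exists (fun w => a / 2 * Qz l w + a^*%C / 2 * Qz (- l) w + Q w).
exists (fun N => 2 * (2 * (sqn (a / 2) * b1 N) + 2 * (sqn (a^*%C / 2) * b2 N)) + 2 * b N).
  apply: cvg0_lin => //.
  have := cvg0_lin (2 * sqn (a / 2)) (2 * sqn (a^*%C / 2)) b10 b20.
  by under eq_fun do rewrite -!mulrA.
move=> w w1; have [IH1 IH2] := IH _ w1.
rewrite /realpart /laurent !big_cons /= -/(realpart P) -/(laurent P w).
have reE : (complex.Re (a * w ^ l))%:C%C = a / 2 * w ^ l + a^*%C / 2 * w ^ (- l).
  by rewrite ReJ_add rmorphM /= unit_exprzJ// mulrDl; ring.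
split.
  rewrite !(hdotDl hdot) !(hdotZl hdot) hatN !cReD !Re_half.
  rewrite -[complex.Re (a^*%C * Qz (- l) w)]cReJ.
  rewrite -[complex.Re (a^*%C * (hat l)^*%C)]cReJ.
  rewrite !rmorphM /= !conjcK.
  have := congr1 (fun x => complex.Re (a * x)) (Qz_sym l w1).
  rewrite mulrDr mulrBr !cReD (raddfN (@complex.Re R)) /=; move: IH1; lra.
move=> N; rewrite psumD psumD !psumZ cReD rmorphD /= reE.
set E1 := psum (v l) N w - w ^ l - Qz l w * ser N w.
set E2 := psum (v (- l)) N w - w ^ (- l) - Qz (- l) w * ser N w.
set E := psum (realpart P) N w - (complex.Re (laurent P w))%:C%C - Q w * ser N w.
have le1 : sqn (a / 2 * E1 + a^*%C / 2 * E2) <=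
    2 * (sqn (a / 2) * b1 N) + 2 * (sqn (a^*%C / 2) * b2 N).
  apply: le_trans (sqnD_le _ _) _; rewrite !sqnM -!(sqnM _ 2^-1).
  by rewrite lerD// ler_pM2l// ler_wpM2l ?sqn_ge0//; [exact: H1|exact: H2].
have -> : a / 2 * psum (v l) N w + a^*%C / 2 * psum (v (- l)) N w
    + psum (realpart P) N w
    - (a / 2 * w ^ l + a^*%C / 2 * w ^ (- l) + (complex.Re (laurent P w))%:C%C)
    - (a / 2 * Qz l w + a^*%C / 2 * Qz (- l) w + Q w) * ser N w
  = (a / 2 * E1 + a^*%C / 2 * E2) + E.
  by rewrite /E1 /E2 /E; ring.
apply: le_trans (sqnD_le _ _) _.
by rewrite lerD// ler_pM2l// IH2.
Qed.

Section singular.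
Context {d2} {T2 : measurableType d2}.
Variables (lam : {measure set T2 -> \bar R}) (w : T2 -> C).
Hypothesis wm : cmeasurable w.
Hypothesis w1 : forall x, sqn (w x) = 1.
Hypothesis lam1 : lam [set: T2] = 1%E.
Hypothesis worth : forall i j : nat,
  inner lam (fun x => w x ^+ i) (fun x => w x ^+ j) = (i == j)%:R.

Lemma mean_psum f N :
  (\int[lam]_x (sqn (psum f N (w x)))%:E = (\sum_(k < N) sqn (coef f k))%:E)%E.
Proof. exact: mean_power_sum. Qed.

Lemma psum_cmeasurable f N : cmeasurable (fun x => psum f N (w x)).
Proof.
rewrite /psum; elim: N => [|N IH].
  by under eq_fun do rewrite big_ord0; exact: cmeasurable_cst.
under eq_fun do rewrite big_ord_recr /=.
apply: cmeasurableD => //; apply: cmeasurableM; first exact: cmeasurable_cst.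
exact: cmeasurableX.
Qed.

(** Singularity of the spectral measure of [e], in the form in which it acts: one real polynomial is
    small for Lebesgue measure, while closeness to 1 for the spectral measure reads as closeness of
    p(U) e to e. *)
Hypothesis sing : forall eps : R, 0 < eps -> exists P : seq (C * int),
  (\int[lam]_x ((complex.Re (laurent P (w x))) ^+ 2)%:E <= eps%:E)%E /\
  nrm2 (e - realpart P) <= eps.

Lemma nrm2_vN1 : nrm2 (v (-1)) = 1.
Proof. by rewrite -(vS (-1)) U'iso addNr v0 /nrm2 e1. Qed.

(** The pointwise bound 1 <= |1 - s|^2 + error is integrated over the circle. As |1 - s| is the
    modulus of the section of [v (-1)], nearly all of the energy |v (-1)|^2 = 1 lies in the first N
    coefficients, and little is left for the N-th iterate. *)
Lemma stable_vN1 : stable dot kacz (v (-1)).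
Proof.
suff H (delta : R) : 0 < delta -> delta <= 1 ->
    exists N, nrm2 (iter N kacz (v (-1))) <= 32 * delta.
  move=> eps eps0; have [||N hN] := H (Num.min 1 (eps / 32)).
  - by rewrite lt_min ltr01 /=; lra.
  - by rewrite ge_min lexx.
  exists N; apply: le_trans hN _; have : Num.min 1 (eps / 32) <= eps / 32.
    by rewrite ge_min lexx orbT.
  lra.
(* The errors below add up to (96 + 32 + 96) eps / delta = 224 eps / delta, which is 16 delta for
   this [eps]; the other 16 delta come from [unimodular_ineq]. *)
move=> d0 d1; pose eps := delta ^+ 2 / 14.
have eps0 : 0 < eps by rewrite divr_gt0// exprn_gt0.
have [P [P1 P2]] := sing eps0.
have [Q [b b0 HQ]] := psum_realpart P.
have [N0 _ HN0] : \forall N \near \oo, b N <= eps.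
  have /cvgrPdist_le := b0 => /(_ _ eps0); apply: filterS => N.
  rewrite sub0r normrN; exact: le_trans (ler_norm _).
(* A successor, because only nonempty sections of [e] are equal to 1. *)
pose N := N0.+1; exists N.
have bN : b N <= eps by apply: HN0 => /=.
set h := e - realpart P; pose p x := complex.Re (laurent P (w x)).
have pw x : 1 <= sqn (psum (v (-1)) N (w x)) +
    (16 * delta + 96 * eps / delta) + 32 / delta * sqn (psum h N (w x))
     + 96 / delta * (p x) ^+ 2.
  have := unimodular_ineq (Q (w x)) (ser N (w x)) d0 d1.
  have -> : 1 - ser N (w x) = w x * psum (v (-1)) N (w x) by rewrite /ser; ring.
  rewrite sqnM w1 mul1r => u.
  have [Q1 Q2] := HQ _ (w1 x).
  have e2b : (2 * complex.Re (Q (w x)) - 1) ^+ 2 <= 2 * eps + 2 * p x ^+ 2.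
    have -> : 2 * complex.Re (Q (w x)) - 1 = - (complex.Re (dot h e) + p x).
      rewrite Q1 /h (hdotBl hdot) e1 cReD (raddfN (@complex.Re R)) /p /=; ring.
    have : complex.Re (dot h e) ^+ 2 <= eps.
      apply: le_trans (Re_sq_le _) _; apply: le_trans P2.
      by apply: le_trans (cauchy_schwarz hdot _ _) _; rewrite /nrm2 e1 mulr1.
    by have := sqr_ge0 (complex.Re (dot h e) - p x); nra.
  (* The number 1 is the section of e = h + p(U) e, so q s - 1 consists of the section of h, the
     value of p and the truncation error. *)
  have e1b : sqn (Q (w x) * ser N (w x) - 1) <=
      2 * sqn (psum h N (w x)) + 4 * p x ^+ 2 + 4 * eps.
    set E := psum (realpart P) N (w x) - (complex.Re (laurent P (w x)))%:C%C
                   - Q (w x) * ser N (w x).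
    have -> : Q (w x) * ser N (w x) - 1 = - psum h N (w x) + - ((p x)%:C%C + E).
      by rewrite /h psumB psum_eS /E /p; ring.
    apply: le_trans (sqnD_le _ _) _; rewrite !sqnN.
    have := sqnD_le (p x)%:C%C E; rewrite sqnR; have := Q2 N; rewrite -/E.
    lra.
  apply: le_trans u _.
  have k0 : 0 <= delta^-1 by rewrite invr_ge0 ltW.
  have := ler_wpM2r k0 (lerD e1b e2b).
  set k := delta^-1; set X1 := sqn (psum h N _); lra.
have m1 f : measurable_fun [set: T2] (fun x => sqn (psum f N (w x))).
  exact/measurable_sqn/psum_cmeasurable.
have m2 : measurable_fun [set: T2] (fun x => p x ^+ 2).
  by apply: measurable_funX; case: (laurent_cmeasurable P wm w1).
have c1 : 0 <= 32 / delta by rewrite divr_ge0 ?ltW.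
have c2 : 0 <= 96 / delta by rewrite divr_ge0 ?ltW.
have c0_ge0 : 0 <= 16 * delta + 96 * eps / delta.
  by rewrite addr_ge0 ?divr_ge0 ?mulr_ge0 ?ltW.
have : (\int[lam]_x (sqn (psum (v (-1)) N (w x)) +
    (16 * delta + 96 * eps / delta) * cst 1 x + 32 / delta * sqn (psum h N (w x))
     + 96 / delta * (p x) ^+ 2)%:E <=
   (\sum_(k < N) sqn (coef (v (-1)) k) + (16 * delta + 96 * eps / delta) * 1
    + 32 / delta * eps + 96 / delta * eps)%:E)%E.
  apply: integral_addZ_le => //.
  - apply: measurable_funD; last exact: measurable_funM.
    by apply: measurable_funD => //; exact: measurable_funM.
  - move=> x; apply: addr_ge0; last by rewrite mulr_ge0 ?sqn_ge0.
    by apply: addr_ge0; rewrite ?sqn_ge0// mulr_ge0.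
  - by move=> x; exact: sqr_ge0.
  apply: integral_addZ_le => //.
  - by apply: measurable_funD => //; exact: measurable_funM.
  - by move=> x; apply: addr_ge0; rewrite ?sqn_ge0// mulr_ge0.
  - by move=> x; exact: sqn_ge0.
  apply: integral_addZ_le => //.
  - by move=> x; exact: sqn_ge0.
  - by rewrite mean_psum.
  - by rewrite (integral_cst lam measurableT 1%:E) lam1 mule1.
  - by rewrite mean_psum lee_fin (le_trans (sum_coef_le h N)).
move=> int2.
have : (1 <= \int[lam]_x (sqn (psum (v (-1)) N (w x)) +
    (16 * delta + 96 * eps / delta) * cst 1 x + 32 / delta * sqn (psum h N (w x))
     + 96 / delta * (p x) ^+ 2)%:E)%E.
  rewrite -[leLHS]mul1e -lam1 -integral_cst//.
  apply: ge0_le_integral => //.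
  - apply/measurable_EFinP.
    apply: measurable_funD; last exact: measurable_funM.
    apply: measurable_funD; last exact: measurable_funM.
    by apply: measurable_funD => //; exact: measurable_funM.
  - by move=> x _; rewrite /= lam1 lee_fin mulr1; exact: pw.
move=> /le_trans/(_ int2); rewrite lee_fin.
have := nrm2_iter_kacz (v (-1)) N; rewrite nrm2_vN1.
have ed : eps / delta = delta / 14 by rewrite /eps; field; rewrite gt_eqF.
have -> : 96 * eps / delta = 96 * (eps / delta) by ring.
have -> : 32 / delta * eps = 32 * (eps / delta) by ring.
have -> : 96 / delta * eps = 96 * (eps / delta) by ring.
rewrite ed; lra.
Qed.

(** Induction away from 0 by means of [kacz_v]: upwards through a preimage, downwards through an
    image. The starting vector [e] is killed by [kacz]. *)
Lemma stable_v l : stable dot kacz (v l).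
Proof.
have kv j : kacz (v (j + 1)) = v j - hat (j + 1) *: v (-1) by exact: kacz_v.
have st := @stableD _ _ _ hdot _ kacz_lin kacz_contr.
elim/int_ind: l => [|n IH|n IH].
- rewrite v0; apply: stable_preimage; rewrite kacz_e; exact: (stable0 hdot).
- rewrite -addn1 PoszD; apply: stable_preimage; rewrite kv; apply: st => //.
  by rewrite -scaleNr; apply: (stableZ hdot kacz_lin); exact: stable_vN1.
- set j := - n.+1%:Z; have jn : - n%:Z = j + 1 by rewrite /j -addn1 PoszD opprD subrK.
  have -> : v j = kacz (v (j + 1)) + hat (j + 1) *: v (-1) by rewrite kv subrK.
  apply: st; last exact: (stableZ hdot kacz_lin _ stable_vN1).
  by rewrite -jn; apply: (stable_image kacz_contr).
Qed.

Theorem kacz_stable f :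
  (forall eps : R, 0 < eps -> exists P : seq (C * int),
     nrm2 (f - \sum_(t <- P) t.1 *: v t.2) <= eps) ->
  stable dot kacz f.
Proof.
move=> H; apply: (stable_closed hdot kacz_lin kacz_contr) => eps e0.
have [P hP] := H _ e0; exists (\sum_(t <- P) t.1 *: v t.2) => //.
apply: (stable_sum hdot kacz_lin kacz_contr) => t _.
by apply: (stableZ hdot kacz_lin); exact: stable_v.
Qed.

End singular.
End kaczmarz.

(** * Density of trigonometric polynomials *)

Section laurent_approximation.
Context {d} {T : measurableType d} {R : realType}.
Local Notation C := R[i].
Variables (nu : {measure set T -> \bar R}) (z : T -> C).
Hypothesis nu_fin : (nu [set: T] < +oo)%E.
Hypothesis zm : cmeasurable z.
Hypothesis z1 : forall x, sqn (z x) = 1.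

Definition approximable (f : T -> C) : Prop := cmeasurable f /\
  forall eps : R, 0 < eps -> exists P : seq (C * int),
    (\int[nu]_x (sqn (f x - laurent P (z x)))%:E <= eps%:E)%E.

Lemma int_sqnD_le (f g : T -> C) (a b : R) :
  cmeasurable f -> cmeasurable g ->
  (\int[nu]_x (sqn (f x))%:E <= a%:E)%E ->
  (\int[nu]_x (sqn (g x))%:E <= b%:E)%E ->
  (\int[nu]_x (sqn (f x + g x))%:E <= (2 * a + 2 * b)%:E)%E.
Proof.
move=> mf mg fa gb.
have h : (\int[nu]_x (0 + 2 * sqn (f x))%:E <= (0 + 2 * a)%:E)%E.
  apply: integral_addZ_le => //; first exact: measurable_sqn.
  - by move=> x; exact: sqn_ge0.
  - by rewrite integral0.
apply: (@le_trans _ _ (\int[nu]_x ((0 + 2 * sqn (f x)) + 2 * sqn (g x))%:E)%E).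
  apply: ge0_le_integral => //.
  - by move=> x _; rewrite lee_fin sqn_ge0.
  - by apply: emeasurable_sqn; exact: cmeasurableD.
  - apply/measurable_EFinP; apply: measurable_funD; last first.
      by apply: measurable_funM => //; exact: measurable_sqn.
    by apply: measurable_funD => //; apply: measurable_funM => //; exact: measurable_sqn.
  - by move=> x _; rewrite lee_fin add0r sqnD_le.
rewrite -[2 * a]add0r; apply: integral_addZ_le => //.
- by apply: measurable_funD => //; apply: measurable_funM => //; exact: measurable_sqn.
- exact: measurable_sqn.
- by move=> x; rewrite add0r mulr_ge0 ?sqn_ge0.
- by move=> x; exact: sqn_ge0.
Qed.

Lemma int_sqnM_le (f g : T -> C) (c a : R) : 0 <= c ->
  cmeasurable f -> cmeasurable g -> (forall x, sqn (f x) <= c) ->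
  (\int[nu]_x (sqn (g x))%:E <= a%:E)%E ->
  (\int[nu]_x (sqn (f x * g x))%:E <= (c * a)%:E)%E.
Proof.
move=> c0 mf mg fc ga.
apply: (@le_trans _ _ (\int[nu]_x (0 + c * sqn (g x))%:E)%E).
  apply: ge0_le_integral => //.
  - by move=> x _; rewrite lee_fin sqn_ge0.
  - by apply: emeasurable_sqn; exact: cmeasurableM.
  - apply/measurable_EFinP; apply: measurable_funD => //.
    by apply: measurable_funM => //; exact: measurable_sqn.
  - by move=> x _; rewrite lee_fin add0r sqnM ler_wpM2r ?sqn_ge0.
rewrite -[c * a]add0r; apply: integral_addZ_le => //.
- exact: measurable_sqn.
- by move=> x; exact: sqn_ge0.
- by rewrite integral0.
Qed.

Lemma approx_closed f : cmeasurable f ->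
  (forall eps : R, 0 < eps -> exists2 g, approximable g &
     (\int[nu]_x (sqn (f x - g x))%:E <= eps%:E)%E) ->
  approximable f.
Proof.
move=> mf H; split=> // eps e0; have e4 : 0 < eps / 4 by lra.
have [g [mg ag] fg] := H _ e4; have [P hP] := ag _ e4; exists P.
have := int_sqnD_le (cmeasurableD mf (cmeasurableN mg))
  (cmeasurableD mg (cmeasurableN (laurent_cmeasurable P zm z1))) fg hP.
under eq_integral do rewrite addrA subrK.
by rewrite (_ : 2 * _ + _ = eps)//; field.
Qed.

Lemma approx_laurent P : approximable (fun x => laurent P (z x)).
Proof.
split; first exact: laurent_cmeasurable.
move=> eps e0; exists P; under eq_integral do rewrite subrr sqn0.
by rewrite integral0 lee_fin ltW.
Qed.

Lemma approx0 : approximable (fun=> 0).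
Proof. by have := approx_laurent [::]; under eq_fun do rewrite /laurent big_nil. Qed.

Lemma approx1 : approximable (fun=> 1).
Proof.
have := approx_laurent [:: (1, 0)].
by under eq_fun do rewrite /laurent big_seq1 expr0z mulr1.
Qed.

Lemma approxD f g :
  approximable f -> approximable g -> approximable (fun x => f x + g x).
Proof.
move=> [mf af] [mg ag]; split; first exact: cmeasurableD.
move=> eps e0; have e4 : 0 < eps / 4 by lra.
have [P hP] := af _ e4; have [Q hQ] := ag _ e4; exists (P ++ Q).
have := int_sqnD_le (cmeasurableD mf (cmeasurableN (laurent_cmeasurable P zm z1)))
  (cmeasurableD mg (cmeasurableN (laurent_cmeasurable Q zm z1))) hP hQ.
under eq_integral do rewrite addrACA -opprD -laurent_cat.
by rewrite (_ : 2 * _ + _ = eps)//; field.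
Qed.

Lemma approxMz (c : C) (l : int) f :
  approximable f -> approximable (fun x => c * z x ^ l * f x).
Proof.
have m1 : cmeasurable (fun x => c * z x ^ l).
  by apply: cmeasurableM; [exact: cmeasurable_cst|exact: exprz_cmeasurable].
move=> [mf af]; split; first exact: cmeasurableM.
move=> eps e0; have c0 : 0 < 1 + sqn c by have := sqn_ge0 c; lra.
have [P hP] := af _ (divr_gt0 e0 c0).
exists [seq (c * t.1, l + t.2) | t <- P].
have -> : eps = (1 + sqn c) * (eps / (1 + sqn c)).
  by rewrite mulrC divfK// gt_eqF.
have := int_sqnM_le (ltW c0) m1
  (cmeasurableD mf (cmeasurableN (laurent_cmeasurable P zm z1))) _ hP.
under eq_integral => x _.
  rewrite mulrBr /laurent mulr_sumr.
  under eq_bigr => t _ do rewrite mulrACA -expfzDr ?unit_neq0//.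
  over.
under [in X in _ -> X]eq_integral do rewrite /laurent big_map.
by apply=> x; rewrite sqnM sqn_exprz// mulr1 lerDr.
Qed.

Lemma approxMlaurent P f :
  approximable f -> approximable (fun x => laurent P (z x) * f x).
Proof.
move=> af; elim: P => [|t P IH].
  by under eq_fun do rewrite /laurent big_nil mul0r; exact: approx0.
under eq_fun do rewrite /laurent big_cons -/(laurent P _) mulrDl.
by apply: approxD => //; exact: approxMz.
Qed.

Lemma approxZ c f : approximable f -> approximable (fun x => c * f x).
Proof. by move=> /(approxMz c 0); under eq_fun do rewrite expr0z mulr1. Qed.

Lemma approxB f g :
  approximable f -> approximable g -> approximable (fun x => f x - g x).
Proof.
move=> af ag; have := approxD af (approxZ (-1) ag).
by under eq_fun do rewrite mulN1r.
Qed.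

(** The factor g, possibly unbounded, is first replaced by a polynomial, at a cost controlled by the
    bound on f; a polynomial times f is then approximable. *)
Lemma approxM f g c : (forall x, sqn (f x) <= c) ->
  approximable f -> approximable g -> approximable (fun x => f x * g x).
Proof.
move=> fc af [mg ag]; apply: approx_closed.
  by apply: cmeasurableM; case: af.
move=> eps e0; have c0 : 0 < 1 + `|c| by have := normr_ge0 c; lra.
have [P hP] := ag _ (divr_gt0 e0 c0).
exists (fun x => f x * laurent P (z x)).
  by under eq_fun do rewrite mulrC; exact: approxMlaurent.
have -> : eps = (1 + `|c|) * (eps / (1 + `|c|)).
  by rewrite mulrC divfK// gt_eqF.
under eq_integral do rewrite -mulrBr.
apply: (int_sqnM_le (ltW c0)) => //; first by case: af.
  by apply: cmeasurableD => //; apply: cmeasurableN; exact: laurent_cmeasurable.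
by move=> x; rewrite (le_trans (fc x))// (le_trans (ler_norm _))// lerDr.
Qed.

Lemma approxX f c n : (forall x, sqn (f x) <= c) ->
  approximable f -> approximable (fun x => f x ^+ n).
Proof.
move=> fc af; elim: n => [|n IH]; first exact: approx1.
by under eq_fun do rewrite exprS; exact: (approxM fc).
Qed.

Lemma approx_sum I (r : seq I) (F : I -> T -> C) :
  (forall i, approximable (F i)) ->
  approximable (fun x => \sum_(i <- r) F i x).
Proof.
move=> aF; elim: r => [|i r IH].
  by under eq_fun do rewrite big_nil; exact: approx0.
by under eq_fun do rewrite big_cons; exact: approxD.
Qed.

Lemma dominated_sqn (F : nat -> T -> C) (f : T -> C) (g : T -> R) :
  (forall n, cmeasurable (F n)) -> cmeasurable f ->
  measurable_fun [set: T] g -> (\int[nu]_x (g x)%:E < +oo)%E ->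
  (forall n x, sqn (f x - F n x) <= g x) ->
  (forall x, (fun n => sqn (f x - F n x)) @ \oo --> (0 : R)) ->
  forall eps : R, 0 < eps -> exists N, forall n, (N <= n)%N ->
    (\int[nu]_x (sqn (f x - F n x))%:E <= eps%:E)%E.
Proof.
move=> mF mf mg ig dom cv eps e0.
have mfF n : cmeasurable (fun x => f x - F n x).
  by apply: cmeasurableD => //; exact: cmeasurableN.
have := @dominated_convergence _ _ _ nu _ measurableT
  (fun n x => (sqn (f x - F n x))%:E) (cst 0%E) (fun x => (g x)%:E).
case.
- by move=> n; exact: emeasurable_sqn.
- exact: measurable_cst.
- apply: aeW => x _; apply: cvg_EFin; first exact: nearW.
  exact: cv.
- apply/integrableP; split; first exact/measurable_EFinP.
  under eq_integral => x _.
    rewrite gee0_abs; first over.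
    by rewrite lee_fin (le_trans _ (dom 0%N x)) ?sqn_ge0.
  exact: ig.
- apply: aeW => x n _; rewrite gee0_abs lee_fin ?sqn_ge0//.
move=> _ _; rewrite integral0 => /fine_cvgP [fn].
move=> /cvgrPdist_le /(_ _ e0) H.
have [N _ hN] := filterI H fn; exists N => n Nn.
have [Hn /= fnn] := hN n Nn; rewrite -(fineK fnn) lee_fin.
by move: Hn; rewrite sub0r normrN; apply: le_trans; exact: ler_norm.
Qed.

Lemma approx_dominated (F : nat -> T -> C) (f : T -> C) (g : T -> R) :
  (forall n, approximable (F n)) -> cmeasurable f ->
  measurable_fun [set: T] g -> (\int[nu]_x (g x)%:E < +oo)%E ->
  (forall n x, sqn (f x - F n x) <= g x) ->
  (forall x, (fun n => sqn (f x - F n x)) @ \oo --> (0 : R)) ->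
  approximable f.
Proof.
move=> aF mf mg ig dom cv; apply: approx_closed => // eps e0.
have mF n : cmeasurable (F n) by case: (aF n).
have [N hN] := dominated_sqn mF mf mg ig dom cv e0.
by exists (F N) => //; exact: hN.
Qed.

Definition rind (E : set T) (x : T) : C := (\1_E x : R)%:C%C.

(** These sets form a sigma-algebra, so that it is enough to reach a generating family. *)
Definition apset (E : set T) : Prop := measurable E /\ approximable (rind E).

Lemma rind_le1 E x : sqn (rind E x) <= 1.
Proof.
by rewrite /rind sqnR indicE; case: (_ \in _); rewrite ?expr1n ?expr0n//= ler01.
Qed.

Lemma rind_cmeasurable E : measurable E -> cmeasurable (rind E).
Proof. by move=> mE; apply: cmeasurable_real; exact: measurable_indic. Qed.

Lemma apsetT : apset [set: T].
Proof.
split=> //; have := approx1; congr (approximable _).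
by apply/funext => x; rewrite /rind indicT.
Qed.

Lemma apsetC E : apset E -> apset (~` E).
Proof.
move=> [mE aE]; split; first exact: measurableC.
have := approxB approx1 aE; congr (approximable _).
apply/funext => x; rewrite /rind !indicE in_setC.
by case: (_ \in _); rewrite /= ?subrr ?subr0.
Qed.

Lemma apsetI E F : apset E -> apset F -> apset (E `&` F).
Proof.
move=> [mE aE] [mF aF]; split; first exact: measurableI.
have := approxM (rind_le1 E) aE aF; congr (approximable _).
apply/funext => x; rewrite /rind !indicE in_setI.
by do 2 case: (_ \in _); rewrite /= ?mulr1 ?mulr0.
Qed.

Lemma apsetU E F : apset E -> apset F -> apset (E `|` F).
Proof.
move=> aE aF; rewrite -[E `|` F]setCK setCU.
by apply: apsetC; apply: apsetI; exact: apsetC.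
Qed.

Lemma apset0 : apset set0.
Proof. by rewrite -setCT; apply: apsetC; exact: apsetT. Qed.

Lemma int_cst_lty (c : R) : (\int[nu]_x (cst c x)%:E < +oo)%E.
Proof.
have finu : nu [set: T] \is a fin_num by rewrite ge0_fin_numE.
by rewrite (integral_cst nu measurableT c%:E) -(fineK finu) -EFinM ltry.
Qed.

(** Supplies the constant dominating function of the convergence arguments, integrable because the
    measures are finite. *)
Lemma sqnB_le4 (a b : C) : sqn a <= 1 -> sqn b <= 1 -> sqn (a - b) <= 4.
Proof. by move=> a1 b1; have := sqnD_le a (- b); rewrite sqnN; lra. Qed.

Lemma apset_bigcup (F : nat -> set T) :
  (forall n, apset (F n)) -> apset (\bigcup_n F n).
Proof.
move=> aF; pose G n := \big[setU/set0]_(i < n) F i.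
have aG n : apset (G n).
  rewrite /G; elim: n => [|n IH]; first by rewrite big_ord0; exact: apset0.
  by rewrite big_ord_recr; exact: apsetU.
have mU : measurable (\bigcup_n F n).
  by apply: bigcupT_measurable => n; case: (aF n).
split=> //.
apply: (@approx_dominated (fun n => rind (G n)) _ (cst 4)).
- by move=> n; case: (aG n).
- exact: rind_cmeasurable.
- exact: measurable_cst.
- exact: int_cst_lty.
- by move=> n x; apply: sqnB_le4; exact: rind_le1.
move=> x; have [[i _ Fix]|nF] := pselect ((\bigcup_n F n) x).
  apply: (@cvg_near_cst _ _ _ _ _); exists i.+1 => // n /= lin.
  rewrite /rind !indicE !mem_set ?subrr ?sqn0//; last by exists i.
  by rewrite /G -(bigcup_mkord n F); exists i.
have h n : sqn (rind (\bigcup_n F n) x - rind (G n) x) = 0.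
  rewrite /rind !indicE !memNset ?subrr ?sqn0//.
  by rewrite /G -(bigcup_mkord n F) => -[i _ Fix]; apply: nF; exists i.
by under eq_fun do rewrite h; exact: cvg_cst.
Qed.

Lemma apset_sigma_algebra : sigma_algebra [set: T] apset.
Proof.
split; [exact: apset0|by move=> A aA; rewrite setTD; exact: apsetC|].
exact: apset_bigcup.
Qed.

End laurent_approximation.

Lemma cvg0_sqr {R : realType} (u : nat -> R) :
  u @ \oo --> (0 : R) -> (fun n => u n ^+ 2) @ \oo --> (0 : R).
Proof.
move=> u0; have h : (u \* u) @ \oo --> (0 * 0 : R) by exact: cvgM.
have -> : (fun n => u n ^+ 2) = u \* u by apply/funext => n; rewrite expr2.
by rewrite mulr0 in h.
Qed.

(** * Polynomials converging to a threshold function on [0, 1] *)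

Section threshold.
Context {R : realType}.
Implicit Types x t : R.

Lemma expr_bernoulli_le x M : 0 <= x -> x <= 1 ->
  (1 - x) ^+ M * (1 + M%:R * x) <= 1.
Proof.
move=> x0 x1; elim: M => [|M IH]; first by rewrite expr0 mul0r addr0 mulr1.
apply: le_trans IH; rewrite exprSr -mulrA ler_wpM2l ?exprn_ge0 ?subr_ge0//.
have -> : M.+1%:R = M%:R + 1 :> R by rewrite natr1.
have : 0 <= M%:R * x ^+ 2 by rewrite mulr_ge0 ?sqr_ge0.
by have := sqr_ge0 x; lra.
Qed.

Lemma expr_bernoulli_ge x M : 0 <= x -> x <= 1 -> 1 - M%:R * x <= (1 - x) ^+ M.
Proof.
move=> x0 x1; elim: M => [|M IH]; first by rewrite expr0 mul0r subr0.
rewrite exprSr; apply: (@le_trans _ _ ((1 - M%:R * x) * (1 - x))).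
  have -> : M.+1%:R = M%:R + 1 :> R by rewrite natr1.
  have : 0 <= M%:R * x ^+ 2 by rewrite mulr_ge0 ?sqr_ge0.
  by lra.
by rewrite ler_wpM2r// subr_ge0.
Qed.

(** With x = r^2, Bernoulli's inequality gives n r^n <= 1 / (1 - r), and another factor r^n
    remains. *)
Lemma cvg_natr_expr x : 0 <= x -> x < 1 ->
  (fun n => n%:R * x ^+ n) @ \oo --> (0 : R).
Proof.
move=> x0 x1; pose r := Num.sqrt x.
have r0 : 0 <= r by exact: sqrtr_ge0.
have r1 : r < 1 by rewrite /r -sqrtr1 ltr_sqrt.
have xr : x = r ^+ 2 by rewrite sqr_sqrtr.
have rg : (fun n => (1 - r)^-1 * r ^+ n) @ \oo --> (0 : R).
  by apply: cvg_geometric; rewrite ger0_norm.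
apply: (@squeeze_cvgr _ _ _ _ (fun=> 0) (fun n => (1 - r)^-1 * r ^+ n));
  [|exact: cvg_cst|exact: rg].
apply: nearW => n; rewrite mulr_ge0 ?exprn_ge0//=.
rewrite xr -exprM mulnC exprM expr2 mulrA ler_wpM2r ?exprn_ge0//.
have d0 : 0 < 1 - r by rewrite subr_gt0.
rewrite -[leRHS]mulr1 ler_pdivlMl// mulrA.
have : 1 - r <= 1 by rewrite gerBl.
move=> d1; have := expr_bernoulli_le n (ltW d0) d1.
rewrite opprB addrC subrK; have := exprn_ge0 n r0; nra.
Qed.

(* The exponent [n 2^n] beats [2^n], so that the limit is 1 also at [t = 1/2]. *)
Definition step_poly n t : R := 1 - (1 - t ^+ n) ^+ (n * 2 ^ n).

Lemma step_poly_bound n t : 0 <= t -> t <= 1 -> 0 <= step_poly n t <= 1.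
Proof.
move=> t0 t1; have h0 := exprn_ge0 n t0; have h1 := exprn_ile1 n t0 t1.
rewrite subr_ge0 gerBl exprn_ge0 ?exprn_ile1 ?subr_ge0 ?gerBl//.
Qed.

(** The two Bernoulli inequalities with M = n 2^n: for t >= 1/2 the defect is at most 1 / (1 + n
    (2t)^n) <= 1 / (n + 1), and for t < 1/2 the value is at most n (2t)^n. *)
Lemma step_poly_cvg t : 0 <= t -> t <= 1 ->
  (fun n => (((1 / 2 <= t)%R)%:R - step_poly n t) ^+ 2) @ \oo --> (0 : R).
Proof.
move=> t0 t1.
suff H : (fun n => ((1 / 2 <= t)%R)%:R - step_poly n t) @ \oo --> (0 : R).
  exact: cvg0_sqr.
have b n := step_poly_bound n t0 t1.
have h0 n := exprn_ge0 n t0; have h1 n := exprn_ile1 n t0 t1.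
have [th|th] := lerP (1 / 2) t.
  apply: (@squeeze_cvgr _ _ _ _ (fun=> 0) (fun n => n.+1%:R^-1));
    [|exact: cvg_cst|exact: cvg_harmonic].
  apply: nearW => n; have /andP[_ b1] := b n; rewrite subr_ge0 b1 /=.
  rewrite /step_poly opprB addrC subrK.
  have n0 : 0 < n.+1%:R :> R by rewrite ltr0n.
  rewrite -[leRHS]mulr1 mulrC ler_pdivlMr//.
  apply: le_trans (expr_bernoulli_le (n * 2 ^ n) (h0 n) (h1 n)).
  rewrite ler_wpM2l ?exprn_ge0 ?subr_ge0//.
  rewrite -nat1r lerD2l natrM natrX -mulrA -exprMn ler_peMr//.
  by rewrite exprn_ege1//; lra.
have s1 : 2 * t < 1 by lra.
have s0 : 0 <= 2 * t by lra.
have hc := cvg_natr_expr s0 s1.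
apply: (@squeeze_cvgr _ _ _ _ (fun n => - (n%:R * (2 * t) ^+ n)) (fun=> 0));
  [|by rewrite -oppr0; exact: cvgN hc|exact: cvg_cst].
apply: nearW => n; have /andP[b0 _] := b n; rewrite sub0r oppr_le0 b0 andbT lerN2.
rewrite /step_poly lerBlDr -lerBlDl.
apply: le_trans (expr_bernoulli_ge (n * 2 ^ n) (h0 n) (h1 n)).
by rewrite natrM natrX exprMn mulrA.
Qed.

End threshold.

Section density.
Context {d} {T : measurableType d} {R : realType}.
Local Notation C := R[i].
Variables (nu : {measure set T -> \bar R}) (z : T -> C).
Hypothesis nu_fin : (nu [set: T] < +oo)%E.
Hypothesis zm : cmeasurable z.
Hypothesis z1 : forall x, sqn (z x) = 1.
Local Notation approximable := (approximable nu z).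
Local Notation apset := (apset nu z).

(** Polynomials in a bounded approximable function are approximable, and [step_poly n] composed with
    u tends to the indicator of the set. *)
Lemma apset_threshold (u : T -> R) : measurable_fun [set: T] u ->
  (forall x, 0 <= u x <= 1) -> approximable (fun x => (u x)%:C%C) ->
  apset [set x | 1 / 2 <= u x].
Proof.
move=> mu u01 au.
have mE : measurable [set x | 1 / 2 <= u x].
  have := mu measurableT _ (measurable_itv `[1 / 2, +oo[); rewrite setTI.
  by congr measurable; apply/seteqP; split=> x /=; rewrite in_itv /= andbT.
split => //.
have ale1 (x : R) : 0 <= x <= 1 -> sqn x%:C%C <= 1.
  by move=> /andP[x0 x1]; rewrite sqnR expr_le1.
apply: (@approx_dominated _ _ _ nu z zm z1 (fun n x => (step_poly n (u x))%:C%C) _ (cst 4)).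
- move=> n.
  have h1 := approxB zm z1 (approx1 nu zm z1) (approxX zm z1 n (fun x => ale1 (u x) (u01 x)) au).
  have h2 : forall x, sqn (1 - (u x)%:C%C ^+ n) <= 1.
    move=> x; have /andP[u0 u1] := u01 x.
    rewrite -rmorphXn -(rmorph1 (real_complex R)) -rmorphB.
    by apply: ale1 => //; rewrite subr_ge0 exprn_ile1//= gerBl exprn_ge0.
  have := approxB zm z1 (approx1 nu zm z1) (approxX zm z1 (n * 2 ^ n) h2 h1).
  congr (_ _ _ _); apply/funext => x.
  by rewrite /step_poly rmorphB rmorphXn rmorphB rmorphXn rmorph1.
- exact: rind_cmeasurable.
- exact: measurable_cst.
- exact: (int_cst_lty nu_fin).
- move=> n x; apply: sqnB_le4; first exact: rind_le1.
  apply: ale1 => //; have /andP[u0 u1] := u01 x; exact: step_poly_bound.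
- move=> x; have /andP[u0 u1] := u01 x.
  have h : (fun n => sqn (rind [set x0 | 1 / 2 <= u x0] x - (step_poly n (u x))%:C%C)) =
      (fun n => (((1 / 2 <= u x)%R)%:R - step_poly n (u x)) ^+ 2).
    apply/funext => n; rewrite /rind -rmorphB sqnR indicE; congr (((nat_of_bool _)%:R - _) ^+ 2).
    by apply/idP/idP; rewrite inE.
  by rewrite h; exact: step_poly_cvg.
Qed.

Lemma apset_halfplane (a : C) (c : R) : sqn a = 1 -> -1 <= c <= 1 ->
  apset [set x | c <= complex.Re (a * z x)].
Proof.
move=> a1 /andP[c0 c1].
(* The difference Re (a z) - c lies in [-2, 2]; dividing by 4 keeps u in [0, 1]. *)
pose u x := 1 / 2 + (complex.Re (a * z x) - c) / 4.
have -> : [set x | c <= complex.Re (a * z x)] = [set x | 1 / 2 <= u x].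
  by apply/seteqP; split => x /=; rewrite /u; lra.
have mre : measurable_fun [set: T] (fun x => complex.Re (a * z x)).
  by have [] := cmeasurableM (cmeasurable_cst a) zm.
apply: apset_threshold.
- apply: measurable_funD => //; apply: measurable_funM => //.
  exact: measurable_funB.
- move=> x; have := Re_sq_le (a * z x); rewrite sqnM a1 z1 mulr1 /u => h.
  by apply/andP; split; nra.
have are : approximable (fun x => (complex.Re (a * z x))%:C%C).
  have := approx_laurent nu zm z1 [:: (a / 2, 1); (a^*%C / 2, -1)].
  congr (_ _ _ _); apply/funext => x.
  rewrite /laurent !big_cons big_nil /= addr0 ReJ_add rmorphM /= expr1z.
  by rewrite -unit_exprzJ// expr1z; ring.
have := approxD zm z1 (approx_laurent nu zm z1 [:: ((1 / 2 - c / 4)%:C%C, 0)])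
  (approxZ zm z1 (4^-1)%:C%C are).
congr (_ _ _ _); apply/funext => x.
by rewrite /laurent big_seq1 expr0z mulr1 /u; apply: eqc => /=; field.
Qed.

Import HBSimple HBNNSimple.

Lemma approx_nnsfun (g : {nnsfun T >-> R}) :
  (forall E, measurable E -> apset E) -> approximable (fun x => (g x)%:C%C).
Proof.
move=> H.
have -> : (fun x => (g x)%:C%C) = (fun x => \sum_(y <- finmap.enum_fset (fset_set (range g)))
    y%:C%C * rind (g @^-1` [set y]) x).
  apply/funext => x; rewrite fimfunE fsbig_finite//= rmorph_sum /=.
  by apply: eq_bigr => y _; rewrite rmorphM.
apply: approx_sum => // y; apply: approxZ => //.
by have [] := H (g @^-1` [set y]) (measurable_funPTI g _).
Qed.

Lemma approx_nonneg (f : T -> R) :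
  (forall E, measurable E -> apset E) -> measurable_fun [set: T] f ->
  (forall x, 0 <= f x) -> (\int[nu]_x ((f x) ^+ 2)%:E < +oo)%E ->
  approximable (fun x => (f x)%:C%C).
Proof.
move=> H mf f0 ff.
have mfE : measurable_fun [set: T] (EFin \o f) by exact/measurable_EFinP.
pose g := nnsfun_approx measurableT mfE.
have fE0 x : [set: T] x -> (0 <= (EFin \o f) x)%E by rewrite lee_fin.
have gc x : (fun n => g n x) @ \oo --> f x.
  have := @cvg_nnsfun_approx _ _ _ _ measurableT _ mfE fE0 x Logic.I.
  by move/fine_cvgP => [].
have gle n x : g n x <= f x.
  have nd : nondecreasing_seq (fun n => g n x).
    by move=> m k mk; have /lefP := nd_nnsfun_approx measurableT mfE mk; apply.
  have := nondecreasing_cvgn_le nd (cvgP _ (gc x)) n.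
  by rewrite (cvg_lim _ (gc x)).
apply: (@approx_dominated _ _ _ nu z zm z1 (fun n x => (g n x)%:C%C) _ (fun x => f x ^+ 2)).
- by move=> n; exact: approx_nnsfun.
- exact: cmeasurable_real.
- exact: measurable_funX.
- exact: ff.
- move=> n x; rewrite -rmorphB sqnR.
  have : 0 <= g n x by []. 
  by have := gle n x; move=> ? ?; rewrite ler_sqr ?nnegrE ?gerBl ?subr_ge0.
- move=> x; under eq_fun do rewrite -rmorphB sqnR.
  have h : (fun n => f x - g n x) @ \oo --> (0 : R).
    have h0 : (fun n => f x - g n x) @ \oo --> (f x - f x).
      by apply: cvgB; [exact: cvg_cst|exact: gc].
    by rewrite subrr in h0.
  exact: cvg0_sqr.
Qed.

Lemma approx_real (f : T -> R) :
  (forall E, measurable E -> apset E) -> measurable_fun [set: T] f ->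
  (\int[nu]_x ((f x) ^+ 2)%:E < +oo)%E ->
  approximable (fun x => (f x)%:C%C).
Proof.
move=> H mf ff.
have le_int (h : T -> R) : measurable_fun [set: T] h ->
    (forall x, h x ^+ 2 <= f x ^+ 2) -> (\int[nu]_x ((h x) ^+ 2)%:E < +oo)%E.
  move=> mh hf; apply: le_lt_trans ff; apply: ge0_le_integral => //.
  - by move=> x _; rewrite lee_fin sqr_ge0.
  - by apply/measurable_EFinP; exact: measurable_funX.
  - by apply/measurable_EFinP; exact: measurable_funX.
  - by move=> x _; rewrite lee_fin.
have mp : measurable_fun [set: T] (fun x => Num.max (f x) 0).
  by apply: measurable_maxr => //.
have mn : measurable_fun [set: T] (fun x => Num.max (- f x) 0).
  by apply: measurable_maxr => //; exact: measurableT_comp.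
have hp := approx_nonneg H mp _ (le_int _ mp _).
have hn := approx_nonneg H mn _ (le_int _ mn _).
have := approxB zm z1 (hp _ _) (hn _ _).
have E : (fun x => (Num.max (f x) 0)%:C%C - (Num.max (- f x) 0)%:C%C) =
   (fun x => (f x)%:C%C :> C).
  apply/funext => x; rewrite -rmorphB; congr (_%:C%C).
  by rewrite !maxEle; do 2 case: ifPn; lra.
rewrite E; apply => x; rewrite ?le_max ?lexx ?orbT// maxEle; case: ifPn => //.
- by rewrite expr0n sqr_ge0.
- by rewrite expr0n sqr_ge0.
- by rewrite sqrrN.
Qed.

Theorem approx_L2 (f : T -> C) :
  (forall E, measurable E -> apset E) -> inL2 nu f -> approximable f.
Proof.
move=> H /inL2P[[mr mi] ff].
have le_int (h : T -> R) : measurable_fun [set: T] h ->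
    (forall x, h x ^+ 2 <= sqn (f x)) -> (\int[nu]_x ((h x) ^+ 2)%:E < +oo)%E.
  move=> mh hf; apply: le_lt_trans ff; apply: ge0_le_integral => //.
  - by move=> x _; rewrite lee_fin sqr_ge0.
  - by apply/measurable_EFinP; exact: measurable_funX.
  - by apply: emeasurable_sqn.
  - by move=> x _; rewrite lee_fin.
have hr := approx_real H mr (le_int _ mr (fun x => Re_sq_le (f x))).
have him : approximable (fun x => (complex.Im (f x))%:C%C).
  apply: approx_real => //; apply: le_int => // x.
  by rewrite /sqn lerDr sqr_ge0.
have := approxD zm z1 hr (approxZ zm z1 'i%C him).
congr (_ _ _ _); apply/funext => x.
by rewrite -complexE.
Qed.

End density.

(** * Exponentials on a unit interval *)

Section expi_theory.
Context {R : realType}.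
Implicit Types a b x : R.

Lemma sqn_expi a : sqn (expi a) = 1.
Proof. by rewrite /sqn /= cos2Dsin2. Qed.

Lemma expiD a b : expi (a + b) = expi a * expi b.
Proof. by apply: eqc; rewrite ?cReM ?cImM /= ?cosD ?sinD //; ring. Qed.

Lemma expi0 : expi (0 : R) = 1.
Proof. by apply: eqc; rewrite /= ?cos0 ?sin0. Qed.

Lemma expiN a : expi (- a) = (expi a)^*%C.
Proof. by apply: eqc; rewrite ?cReJ ?cImJ /= ?cosN ?sinN. Qed.

Lemma expiX a n : expi (n%:R * a) = expi a ^+ n.
Proof.
elim: n => [|n IH]; first by rewrite mul0r expi0.
have -> : n.+1%:R = n%:R + 1 :> R by rewrite natr1.
by rewrite mulrDl mul1r expiD IH exprSr.
Qed.

Lemma expi_2pi : expi (2 * pi : R) = 1.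
Proof. by apply: eqc; rewrite /= mulr_natl ?cos2pi ?sin2pi. Qed.

Lemma expi_2pi_int (k : int) : expi (2 * pi * k%:~R : R) = 1.
Proof.
have h n : expi (2 * pi * n%:R : R) = 1 by rewrite mulrC expiX expi_2pi expr1n.
by case: k => n; rewrite ?NegzE ?mulrNz ?mulrN ?expiN -?pmulrn h ?conjc1.
Qed.

Lemma expi_cmeasurable d (T : measurableType d) (f : T -> R) :
  measurable_fun [set: T] f -> cmeasurable (fun t => expi (f t)).
Proof.
move=> mf; split.
  apply: (measurableT_comp (f := @cos R)) => //.
  by apply: continuous_measurable_fun; exact: continuous_cos.
apply: (measurableT_comp (f := @sin R)) => //.
by apply: continuous_measurable_fun; exact: continuous_sin.
Qed.

Lemma continuous_cos_affine (c p : R) : continuous (fun x => cos (c * x + p)).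
Proof.
move=> x; apply: (@continuous_comp _ _ _ (fun x => c * x + p) (@cos R)).
  by apply: continuousD; [exact: mulrl_continuous|exact: cst_continuous].
exact: continuous_cos.
Qed.

Lemma integral_cosM (c p a b : R) : c != 0 -> a < b ->
  \int[lebesgue_measure]_(x in `[a, b]) cos (c * x + p) =
  (sin (c * b + p) - sin (c * a + p)) / c.
Proof.
move=> c0 ab; pose F (x : R) : R := sin (c * x + p) / c.
have dF x : is_derive x 1 F (cos (c * x + p)).
  have h : is_derive x 1 (fun y : R => c * y + p) (c * 1 + 0).
    apply: is_deriveD; exact: is_deriveZ.
  have h2 := @is_derive1_comp R (@sin R) (fun y => c * y + p) x _ _
    (is_derive_sin (c * x + p)) h.
  have h3 : is_derive x (1 : R) (c^-1 \*: (@sin R \o (fun y => c * y + p)))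
      (c^-1 *: (cos (c * x + p) * (c * 1 + 0))) by exact: is_deriveZ.
  have -> : F = c^-1 \*: (@sin R \o (fun y => c * y + p)).
    by apply/funext => y; rewrite /F mulrC.
  apply: is_derive_eq; rewrite /GRing.scale /=.
  by field.
rewrite /Rintegral (@continuous_FTC2 _ _ F)//.
- by rewrite /F /= mulrBl.
- apply: continuous_in_subspaceT => x _; exact: continuous_cos_affine.
- split.
  + by move=> x _; apply: ex_derive.
  + apply: cvg_at_right_filter; apply/differentiable_continuous.
    by apply/derivable1_diffP; apply: ex_derive.
  + apply: cvg_at_left_filter; apply/differentiable_continuous.
    by apply/derivable1_diffP; apply: ex_derive.
- by move=> x _; rewrite derive1E; apply: derive_val.
Qed.

End expi_theory.

Section restricted_measure.
Context {d} {T : measurableType d} {R : realType}.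
Variables (mu : {measure set T -> \bar R}) (D : set T) (mD : measurable D).

Lemma integral_mrestr (f : T -> \bar R) : measurable_fun [set: T] f ->
  (\int[mrestr mu mD]_x f x = \int[mu]_(x in D) f x)%E.
Proof.
move=> mf; transitivity (\int[mrestr mu mD]_(x in D) f x)%E.
  rewrite [RHS]integral_mkcond; apply: ae_eq_integral => //.
    by apply/(measurable_restrictT _ mD); exact: measurable_funTS.
  exists (~` D); split; first exact: measurableC.
    by rewrite /= /mrestr setICl measure0.
  move=> x /= h Dx; apply: h => _.
  by rewrite patchE mem_set.
by apply: eq_measure_integral => A mA AD; rewrite /= /mrestr setIidl.
Qed.

End restricted_measure.

Section slices.
Context {R : realType}.
Local Notation T := (measurableTypeR R).
Local Notation C := R[i].

Definition slice (k : int) : set T := [set y : R | Num.floor y = k].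

Lemma sliceE k : slice k = `[k%:~R, (k + 1)%:~R[%classic.
Proof.
apply/seteqP; split => y /=; rewrite in_itv /= /slice /=.
  by move=> /eqP; rewrite floor_eq.
by move=> h; apply/eqP; rewrite floor_eq.
Qed.

Lemma measurable_slice k : measurable (slice k).
Proof. by rewrite sliceE; exact: measurable_itv. Qed.

Definition ez (y : T) : C := expi (2 * pi * (y : R)).

Lemma sqn_ez y : sqn (ez y) = 1. Proof. exact: sqn_expi. Qed.

Lemma ez_cmeasurable : cmeasurable ez.
Proof. by apply: expi_cmeasurable; apply: mulrl_measurable. Qed.

Lemma ezD_int (k : int) (x : R) : ez (k%:~R + x) = ez x.
Proof. by rewrite /ez mulrDr expiD expi_2pi_int mul1r. Qed.

Definition leb_slice (k : int) : {measure set T -> \bar R} :=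
  mrestr (@lebesgue_measure R) (measurable_slice k).

Lemma leb_slice1 k : leb_slice k [set: T] = 1%E.
Proof.
rewrite /leb_slice /= /mrestr setTI sliceE lebesgue_measure_itv /=.
rewrite lte_fin ltr_int ltzD1 lexx -EFinB; congr EFin.
by rewrite intrD addrC addKr.
Qed.

(** An interval of length 1 holds a whole number of periods, as expi c = 1 says. The phase [p] lets
    the same lemma serve for sines, with p = - pi / 2. *)
Lemma integral_slice_cosM k (c p : R) : c != 0 -> expi c = 1 ->
  \int[leb_slice k]_x cos (c * (x : R) + p) = 0.
Proof.
move=> c0 c1.
have [mc _] : cmeasurable (fun x : T => expi (c * (x : R) + p)).
  apply: expi_cmeasurable; apply: measurable_funD; last exact: measurable_cst.
  exact: mulrl_measurable.
rewrite /Rintegral integral_mrestr; last exact/measurable_EFinP.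
rewrite -/(Rintegral _ _ _) sliceE Rintegral_itv_bndo_bndc.
  rewrite integral_cosM//; last by rewrite ltr_int ltzD1.
  have -> : c * (k + 1)%:~R + p = (c * k%:~R + p) + c by rewrite intrD; ring.
  have := expiD (c * k%:~R + p) c; rewrite c1 mulr1 => -[_ ->].
  by rewrite subrr mul0r.
have ic : (@lebesgue_measure R).-integrable `[k%:~R, (k + 1)%:~R]%classic
    (EFin \o (fun x : R => cos (c * x + p))).
  apply: continuous_compact_integrable; first exact: segment_compact.
  by apply: continuous_in_subspaceT => x _; exact: continuous_cos_affine.
apply: integrableS ic => //.
by apply: subset_itvl; rewrite bnd_simp.
Qed.

Lemma ez_orthonormal k (i j : nat) :
  inner (leb_slice k) (fun x => ez x ^+ i) (fun x => ez x ^+ j) = (i == j)%:R.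
Proof.
pose c : R := i%:R * (2 * pi) - j%:R * (2 * pi).
have c1 : expi c = 1.
  by rewrite expiD expiN (expiX _ i) (expiX _ j) expi_2pi !expr1n conjc1 mulr1.
have eE y : ez y ^+ i * (ez y ^+ j)^*%C = expi (c * (y : R)).
  by rewrite /ez -!expiX -expiN -expiD; congr expi; rewrite /c; ring.
rewrite /inner /cintegral; have [ij|ij] := eqVneq i j.
  have c0 : c = 0 by rewrite /c ij subrr.
  apply: eqc => /=.
    transitivity (\int[leb_slice k]_x (1 : R))%R.
      by apply: eq_Rintegral => y _; rewrite eE c0 mul0r expi0.
    rewrite Rintegral_cst// mul1r; have := leb_slice1 k.
    by rewrite /= => ->.
  transitivity (\int[leb_slice k]_x (0 : R))%R.
    by apply: eq_Rintegral => y _; rewrite eE c0 mul0r expi0.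
  by rewrite Rintegral_cst// mul0r.
have c0 : c != 0.
  rewrite /c subr_eq0 (inj_eq (mulIf _)) ?eqr_nat//.
  by rewrite mulf_neq0 ?pnatr_eq0// gt_eqF ?pi_gt0.
apply: eqc => /=.
  rewrite -[RHS](integral_slice_cosM k 0 c0 c1).
  by apply: eq_Rintegral => y _; rewrite eE addr0.
rewrite -[RHS](integral_slice_cosM k (- (pi / 2)) c0 c1).
by apply: eq_Rintegral => y _; rewrite eE cosBpihalf.
Qed.

(** The sign of the imaginary part of e^(2 pi i y) tells in which half of the interval y lies, and
    on each half the cosine is monotone. Inside one interval a ray is therefore a Boolean
    combination of half-planes in the variable e^(2 pi i y). *)
Lemma slice_ge (k : int) (t y : R) : slice k y ->
  let x := y - k%:~R in let s := t - k%:~R in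
  t <= y <->
  if s <= 0 then true else if s <= 1 / 2 then
    (complex.Im (ez y) < 0) || (complex.Re (ez y) <= cos (2 * pi * s))
  else if s < 1 then
    (complex.Im (ez y) < 0) && (cos (2 * pi * s) <= complex.Re (ez y))
  else false.
Proof.
move=> yk x s.
have /andP[ky {}yk] : k%:~R <= y < k%:~R + 1.
  by move: yk; rewrite sliceE /= in_itv /= intrD.
have -> : ez y = ez x by rewrite -(ezD_int k x) addrC subrK.
have -> : (t <= y) = (s <= x) by rewrite lerD2r.
have x0 : 0 <= x by rewrite subr_ge0.
have x1 : x < 1 by rewrite ltrBlDl.
have pi0 : 0 < pi :> R := pi_gt0 R.
have le_cos (u v : R) : 0 <= u -> u <= 1 / 2 -> 0 <= v -> v <= 1 / 2 ->
    (cos (2 * pi * u) <= cos (2 * pi * v)) = (v <= u).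
  move=> u0 u1 v0 v1; rewrite !leNgt ltr_cos; last 2 first.
  - by rewrite in_itv /=; apply/andP; split; nra.
  - by rewrite in_itv /=; apply/andP; split; nra.
  by rewrite ltr_pM2l// mulr_gt0.
have refl (u : R) : cos (2 * pi * u) = cos (2 * pi * (1 - u)).
  have -> : 2 * pi * (1 - u) = - (2 * pi * u) + pi *+ 2 by rewrite -mulr_natl; ring.
  by rewrite cosD2pi cosN.
have sin_hi (u : R) : 1 / 2 < u -> u < 1 -> sin (2 * pi * u) < 0.
  move=> u0 u1; have -> : 2 * pi * u = (2 * pi * u - pi) + pi by rewrite subrK.
  rewrite sinDpi oppr_lt0 sin_gt0_pi//; apply/andP; split; nra.
have sin_lo (u : R) : 0 <= u -> u <= 1 / 2 -> 0 <= sin (2 * pi * u).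
  by move=> u0 u1; rewrite sin_ge0_pi//; apply/andP; split; nra.
have -> : complex.Im (ez x) = sin (2 * pi * x) by [].
have -> : complex.Re (ez x) = cos (2 * pi * x) by [].
case: (lerP s 0) => s0; first by split=> // _; lra.
case: (lerP s (1 / 2)) => s1.
  case: (lerP x (1 / 2)) => xh.
    by rewrite ltNge sin_lo//= le_cos// ltW.
  rewrite sin_hi//=; split=> // _; lra.
case: (ltP s 1) => s2; last by split=> // ?; lra.
case: (lerP x (1 / 2)) => xh.
  by rewrite ltNge sin_lo//=; split => // ?; lra.
rewrite sin_hi//= refl (refl x) le_cos; [|lra..].
by rewrite lerD2l lerN2.
Qed.

End slices.

Section approx_ae.
Context {d} {T : measurableType d} {R : realType}.
Variables (nu : {measure set T -> \bar R}) (z : T -> R[i]).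
Hypothesis zm : cmeasurable z.
Hypothesis z1 : forall x, sqn (z x) = 1.

Lemma int_sqn_ae (f g : T -> R[i]) (D : set T) : measurable D ->
  nu (~` D) = 0%E -> cmeasurable f -> cmeasurable g ->
  (forall x, D x -> f x = g x) ->
  (\int[nu]_x (sqn (f x))%:E = \int[nu]_x (sqn (g x))%:E)%E.
Proof.
move=> mD D0 mf mg fg; apply: ge0_ae_eq_integral => //.
- exact: emeasurable_sqn.
- exact: emeasurable_sqn.
- by move=> x _; rewrite lee_fin sqn_ge0.
- by move=> x _; rewrite lee_fin sqn_ge0.
exists (~` D); split => //; first exact: measurableC.
by move=> x /= h Dx; apply: h => _; rewrite fg.
Qed.

Lemma apset_ae (E F D : set T) : measurable D -> nu (~` D) = 0%E ->
  measurable F -> E `&` D = F `&` D -> apset nu z E -> apset nu z F.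
Proof.
move=> mD D0 mF EF [mE [mE' aE]]; split=> //; split; first exact: rind_cmeasurable.
move=> eps e0; have [P hP] := aE _ e0; exists P.
apply: le_trans hP; rewrite le_eqVlt; apply/orP; left; apply/eqP.
have mP := laurent_cmeasurable P zm z1.
apply: (int_sqn_ae mD D0).
- by apply: cmeasurableD; [exact: rind_cmeasurable|exact: cmeasurableN].
- by apply: cmeasurableD; [exact: rind_cmeasurable|exact: cmeasurableN].
move=> x Dx; rewrite /rind !indicE; congr ((_%:R)%:C%C - _).
have /seteqP[h1 h2] := EF.
by congr nat_of_bool; apply/idP/idP; rewrite !inE => h; [have [] := h2 x|have [] := h1 x].
Qed.

End approx_ae.

Section slice_density.
Context {R : realType}.
Local Notation T := (measurableTypeR R).
Local Notation C := R[i].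

(** The rays [t, +oo) generate the Borel sets, and on the interval that carries [nu] each of them is
    a Boolean combination of half-planes. *)
Lemma apset_slice (nu : {measure set T -> \bar R}) (k : int) :
  (nu [set: T] < +oo)%E -> nu (~` slice k) = 0%E ->
  forall E, measurable E -> apset nu ez E.
Proof.
move=> fin nuk E.
have zm := @ez_cmeasurable R; have z1 := @sqn_ez R.
have -> : measurable E = (@RGenCInfty.G R).-sigma.-measurable E.
  by rewrite -RGenCInfty.measurableE.
apply: smallest_sub; first exact: (apset_sigma_algebra fin zm z1).
move=> _ [t ->].
set s := t - k%:~R.
(* The directions - i, - 1 and 1 of the half-planes test the sign of the imaginary part, an upper
   bound and a lower bound on the real part. *)
have nI : sqn (- 'i%C : C) = 1 by rewrite /sqn /=; ring.
have nN : sqn (- 1 : C) = 1 by rewrite /sqn /=; ring.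
have c1 : -1 <= cos (2 * pi * s) <= 1 by rewrite cos_geN1 cos_le1.
have c2 : -1 <= - cos (2 * pi * s) <= 1 by rewrite lerN2 cos_le1 lerNl cos_geN1.
have c3 : -1 <= (0 : R) <= 1 by rewrite lerN10 ler01.
have h1 := apsetC zm z1 (apset_halfplane fin zm z1 nI c3).
have h2 := apset_halfplane fin zm z1 nN c2.
have h3 := apset_halfplane fin zm z1 sqn1 c1.
pose E' : set T := if s <= 0 then setT else if s <= 1 / 2 then
  ~` [set y | 0 <= complex.Re (- 'i%C * ez y)] `|`
     [set y | - cos (2 * pi * s) <= complex.Re (- 1 * ez y)]
  else if s < 1 then ~` [set y | 0 <= complex.Re (- 'i%C * ez y)] `&`
     [set y | cos (2 * pi * s) <= complex.Re (1 * ez y)] else set0.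
apply: (@apset_ae _ _ _ nu ez zm z1 E' _ (slice k)) => //.
- exact: measurable_slice.
- have hI (y : T) : ~ (0 <= complex.Re (- 'i%C * ez y)) <-> complex.Im (ez y) < 0.
    have -> : complex.Re (- 'i%C * ez y) = complex.Im (ez y) by rewrite cReM /=; ring.
    by rewrite ltNge; split => /negP.
  have hN (y : T) : (- cos (2 * pi * s) <= complex.Re (- 1 * ez y)) <->
      (complex.Re (ez y) <= cos (2 * pi * s)).
    by rewrite mulN1r (raddfN (@complex.Re R)) lerN2.
  have h1P (y : T) : (cos (2 * pi * s) <= complex.Re (1 * ez y)) <->
      (cos (2 * pi * s) <= complex.Re (ez y)) by rewrite mul1r.
  apply/seteqP; split => y [h Dy]; split => //; move: h;
    have := slice_ge t Dy; rewrite -/s /E'; set a := complex.Im (ez y); set b := complex.Re (ez y);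
    rewrite [`[t, +oo[%classic y]/= in_itv /= andbT => sg.
  + case: ifPn sg => _; first by move=> ->.
    case: ifPn => _.
      move=> sg [/hI h|/hN h]; first by apply/sg; rewrite h.
      by apply/sg; rewrite h orbT.
    case: ifPn => _ // sg [/hI h1' /h1P h2'].
    by apply/sg; rewrite h1' h2'.
  + case: ifPn sg => _ //; case: ifPn => _.
      by move=> sg /sg /orP[h|h]; [left; apply/hI|right; apply/hN].
    case: ifPn => _ sg /sg // /andP[h h'].
    by split; [apply/hI|apply/h1P].
- rewrite /E'; case: ifP => _; first exact: apsetT.
  case: ifP => _; first exact: apsetU.
  by case: ifP => _; [exact: apsetI|exact: apset0].
Qed.

Variable mu : probability T R.
Variable (k : int).
Local Notation mu_k := (mrestr mu (measurable_slice k)).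

Lemma mrestr_slice_fin : (mu_k [set: T] < +oo)%E.
Proof.
rewrite /= /mrestr setTI; apply: le_lt_trans (probability_le1 mu _) _ => //.
  exact: measurable_slice.
exact: ltry.
Qed.

Lemma mrestr_sliceC : mu_k (~` slice k) = 0%E.
Proof. by rewrite /= /mrestr setICl measure0. Qed.

(** The separating set A is Lebesgue null and carries mu. Approximating its indicator for the sum of
    the two measures gives a single polynomial, near 0 for the one and near 1 for the other. *)
Lemma slice_singular : mutually_singular (@lebesgue_measure R) mu ->
  forall eps : R, 0 < eps -> exists P : seq (C * int),
  (\int[leb_slice k]_y ((complex.Re (laurent P (ez y))) ^+ 2)%:E <= eps%:E)%E /\
  (\int[mu_k]_y ((1 - complex.Re (laurent P (ez y))) ^+ 2)%:E <= eps%:E)%E.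
Proof.
move=> [A [mA lA muA]] eps e0.
have zm := @ez_cmeasurable R; have z1 := @sqn_ez R.
pose nu : {measure set T -> \bar R} := measure_add mu_k (leb_slice k).
have nufin : (nu [set: T] < +oo)%E.
  have -> : nu [set: T] = (mu_k [set: T] + leb_slice k [set: T])%E by exact: measure_addE.
  by rewrite leb_slice1 lte_add_pinfty ?ltry// mrestr_slice_fin.
have nuC : nu (~` slice k) = 0%E.
  have -> : nu (~` slice k) = (mu_k (~` slice k) + leb_slice k (~` slice k))%E
    by exact: measure_addE.
  by rewrite mrestr_sliceC add0e /= /mrestr setICl measure0.
have [_ [_ /(_ _ e0) [P hP]]] := apset_slice nufin nuC mA.
exists P; move: hP; have mP := laurent_cmeasurable P zm z1.
have mAP : cmeasurable (fun y => rind A y - laurent P (ez y)).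
  by apply: cmeasurableD; [exact: rind_cmeasurable|exact: cmeasurableN].
rewrite ge0_integral_measure_add//; last 2 first.
- by move=> y _; rewrite lee_fin sqn_ge0.
- exact: emeasurable_sqn.
move=> hP.
have mRe : measurable_fun [set: T] (fun y => complex.Re (laurent P (ez y))) by case: mP.
split.
  have lebA : leb_slice k (~` (~` A)) = 0%E.
    rewrite setCK; apply/eqP; rewrite -measure_le0 /= /mrestr -lA.
    by apply: le_measure; rewrite ?inE//; apply: measurableI => //; exact: measurable_slice.
  apply: le_trans hP; apply: le_trans (leeDr _ _); last exact: int_sqn_ge0.
  rewrite (int_sqn_ae (measurableC mA) lebA (g := fun y => - laurent P (ez y)))//.
  - apply: ge0_le_integral => //.
    + by move=> y _; rewrite lee_fin sqr_ge0.
    + by apply/measurable_EFinP; exact: measurable_funX.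
    + by apply: emeasurable_sqn; exact: cmeasurableN.
    + by move=> y _; rewrite lee_fin sqnN Re_sq_le.
  - exact: cmeasurableN.
  - by move=> y /= Ay; rewrite /rind indicE memNset// sub0r.
have muA' : mu_k (~` A) = 0%E.
  apply/eqP; rewrite -measure_le0 /= /mrestr -muA.
  apply: le_measure; rewrite ?inE//; last exact: measurableC.
  by apply: measurableI; [exact: measurableC|exact: measurable_slice].
apply: le_trans hP; apply: le_trans (leeDl _ _); last exact: int_sqn_ge0.
rewrite (int_sqn_ae mA muA' (g := fun y => 1 - laurent P (ez y)))//.
- apply: ge0_le_integral => //.
  + by move=> y _; rewrite lee_fin sqr_ge0.
  + by apply/measurable_EFinP; apply: measurable_funX; exact: measurable_funB.
  + by apply: emeasurable_sqn; apply: cmeasurableD; [exact: cmeasurable_cst|exact: cmeasurableN].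
  + move=> y _; rewrite lee_fin; apply: le_trans (Re_sq_le _).
    by rewrite cReD (raddfN (@complex.Re R)).
- by apply: cmeasurableD; [exact: cmeasurable_cst|exact: cmeasurableN].
- by move=> y /= Ay; rewrite /rind indicE mem_set.
Qed.

Lemma slice_dense (f : T -> C) : inL2 mu f -> forall eps : R, 0 < eps ->
  exists P : seq (C * int),
  (\int[mu_k]_y (sqn (f y - laurent P (ez y)))%:E <= eps%:E)%E.
Proof.
move=> /inL2P[mf ff].
have zm := @ez_cmeasurable R; have z1 := @sqn_ez R.
have aE := apset_slice mrestr_slice_fin mrestr_sliceC.
have [] // : approximable mu_k ez f.
apply: approx_L2 => //; apply/inL2P; split => //.
rewrite integral_mrestr; last exact: emeasurable_sqn.
apply: le_lt_trans ff; apply: ge0_subset_integral => //.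
- exact: measurable_slice.
- exact: emeasurable_sqn.
- by move=> y _; rewrite lee_fin sqn_ge0.
Qed.

End slice_density.

(** * Conditional expectation given the integer part *)

Section L2_multiplication.
Context {d} {T : measurableType d} {R : realType}.
Local Notation C := R[i].
Variable mu : {measure set T -> \bar R}.
Variables (g : T -> C) (gm : cmeasurable g) (g1 : forall x, sqn (g x) <= 1).
Local Notation L2 := (L2 mu).
Local Notation dot := (@dot d T R mu).
Local Notation nrm2 := (nrm2 dot).

Definition L2mul (f : L2) : L2 := MkL2 (inL2M gm g1 (L2P f)).

Lemma L2mul_lin c f h : L2mul (c *: f + h) = c *: L2mul f + L2mul h.
Proof. by apply: L2_ext => x /=; rewrite mulrDr mulrCA. Qed.

Lemma nrm2_L2mul f : (forall x, sqn (g x) = 1) -> nrm2 (L2mul f) = nrm2 f.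
Proof.
move=> gx1; apply: EFin_inj; rewrite !nrm2E; apply: eq_integral => x _ /=.
by rewrite sqnM gx1 mul1r.
Qed.

End L2_multiplication.

Lemma dot_L2mul {d} {T : measurableType d} {R : realType}
  (mu : {measure set T -> \bar R}) (g h : T -> R[i])
  (gm : cmeasurable g) (g1 : forall x, sqn (g x) <= 1)
  (hm : cmeasurable h) (h1 : forall x, sqn (h x) <= 1) (f k : L2 mu) :
  (forall x, h x = (g x)^*%C) ->
  dot (L2mul gm g1 f) k = dot f (L2mul hm h1 k).
Proof.
move=> hg; rewrite /dot /inner; congr cintegral; apply/funext => x /=.
by rewrite rmorphM /= hg conjcK mulrA [g x * _]mulrC.
Qed.

Lemma dot_ext {d} {T : measurableType d} {R : realType}
  (mu : {measure set T -> \bar R}) (f f' k k' : L2 mu) :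
  (forall x, f x * (k x)^*%C = f' x * (k' x)^*%C) -> dot f k = dot f' k'.
Proof. by move=> h; rewrite /dot /inner; congr cintegral; apply/funext. Qed.

Section condexp.
Context {R : realType}.
Local Notation T := (measurableTypeR R).
Local Notation C := R[i].
Variable mu : probability T R.
Local Notation L2 := (L2 mu).
Local Notation dot := (@dot _ T R mu).
Local Notation nrm2 := (nrm2 dot).
Let hdot : pos_hermitian dot := L2_pos_hermitian mu.

Lemma mu_fin : (mu [set: T] < +oo)%E.
Proof. by rewrite probability_setT ltry. Qed.

(** A preimage is a countable union of slices. *)
Lemma floor_cmeasurable (F : int -> C) : cmeasurable (fun y : T => F (Num.floor (y : R))).
Proof.
have h (G : int -> R) : measurable_fun [set: T] (fun y : T => G (Num.floor (y : R))).
  move=> _ B mB; rewrite setTI.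
  have -> : (fun y : T => G (Num.floor (y : R))) @^-1` B =
      \bigcup_k (if `[< B (G k) >] then slice k else set0).
    apply/seteqP; split => y /=.
      by move=> By; exists (Num.floor (y : R)) => //; rewrite asboolT.
    by case=> k _; case: asboolP => // Bk; rewrite /slice /= => ->.
  apply: countable_bigcupT_measurable => [|k]; first exact: countableP.
  by case: ifP => _ //; exact: measurable_slice.
by split; [exact: (h (fun k => complex.Re (F k)))|exact: (h (fun k => complex.Im (F k)))].
Qed.

Definition sone (k : int) : L2 :=
  MkL2 (inL2_bounded mu_fin (rind_cmeasurable (measurable_slice k)) (rind_le1 (slice k))).

Lemma rind_sliceE (k : int) (y : T) : rind (slice k) y = (Num.floor (y : R) == k)%:R :> C.
Proof.
rewrite /rind indicE rmorph_nat.
suff -> : (y \in slice k) = (Num.floor (y : R) == k) by [].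
by apply/idP/eqP; rewrite inE.
Qed.

Definition sind (k : int) : L2 -> L2 :=
  L2mul (rind_cmeasurable (measurable_slice k)) (rind_le1 (slice k)).

Lemma sindE k (f : L2) y : sind k f y = (Num.floor (y : R) == k)%:R * f y.
Proof. by rewrite /= rind_sliceE. Qed.

Definition pslice (k : int) : R := nrm2 (sone k).

Lemma dot_sone k : dot (sone k) (sone k) = (pslice k)%:C%C.
Proof. exact: (hdotff hdot). Qed.

Lemma int_slice_sqn (f : L2) k :
  (\int[mu]_(y in slice k) (sqn (f y))%:E = (nrm2 (sind k f))%:E)%E.
Proof.
rewrite nrm2E [LHS]integral_mkcond; apply: eq_integral => y _.
rewrite sindE patchE; case: ifPn => [|].
  by rewrite inE /slice /= => ->; rewrite eqxx mul1r.
by move=> /negP h; case: eqP => [e|_]; [exfalso; apply: h; rewrite inE|rewrite mul0r sqn0].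
Qed.

Lemma mu_sliceE k : mu (slice k) = (pslice k)%:E.
Proof.
rewrite /pslice nrm2E; under eq_integral => y _.
  have -> : (sqn (sone k y))%:E = (\1_(slice k) y)%:E :> \bar R.
    by rewrite /= sqnR indicE; case: (_ \in _); rewrite ?expr1n ?expr0n.
  over.
by rewrite integral_indic ?setIT//; exact: measurable_slice.
Qed.

Lemma dot_sind k (f h : L2) : dot (sind k f) h = dot f (sind k h).
Proof. by apply: dot_L2mul => x; rewrite rind_sliceE rmorph_nat. Qed.

Lemma sind_sone k : sind k (sone k) = sone k.
Proof. by apply: L2_ext => y; rewrite sindE /= rind_sliceE -natrM mulnb andbb. Qed.

(** On a null slice the division by 0 returns 0, so the average is 0 there. *)
Definition cavg (f : L2) (k : int) : C := dot f (sone k) / (pslice k)%:C%C.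

Lemma pslice_ge0 k : 0 <= pslice k. Proof. exact: (nrm2_ge0 hdot). Qed.

Lemma cavg_le (f : L2) k : sqn (cavg f k) * pslice k <= nrm2 (sind k f).
Proof.
rewrite /cavg sqnM.
have -> : dot f (sone k) = dot (sind k f) (sone k) by rewrite dot_sind sind_sone.
have cs := cauchy_schwarz hdot (sind k f) (sone k).
rewrite -fmorphV sqnR; have [->|p0] := eqVneq (pslice k) 0.
  by rewrite mulr0 (nrm2_ge0 hdot).
have pp : 0 < pslice k by rewrite lt_neqAle eq_sym p0 pslice_ge0.
rewrite -mulrA (_ : _ ^-1 ^+ 2 * _ = (pslice k)^-1); last by field.
by rewrite ler_pdivrMr.
Qed.

(** The slices indexed by natural numbers. With [pickle_inv] every integer has exactly one index,
    hence disjointness; an index that codes no integer gets the empty set. *)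
Definition islice (n : nat) : set T :=
  if (pickle_inv n : option int) is Some k then slice k else set0.

Lemma islice_cover : \bigcup_n islice n = [set: T].
Proof.
rewrite -subTset => y _; exists (pickle (Num.floor (y : R))); first exact: Logic.I.
by rewrite /islice pickleK_inv.
Qed.

Lemma measurable_islice n : measurable (islice n).
Proof. by rewrite /islice; case: pickle_inv => // k; exact: measurable_slice. Qed.

Lemma islice_triv : trivIset [set: nat] islice.
Proof.
move=> m n _ _ [y]; rewrite /islice.
have := @pickle_invK int m; have := @pickle_invK int n.
case: (pickle_inv n) => [j|]; case: (pickle_inv m) => [i|] /= hj hi [] //.
by rewrite /slice /= => ei ej; rewrite -hi -hj -ei -ej.
Qed.

Lemma integral_islice (f : T -> \bar R) : measurable_fun [set: T] f ->
  (forall x, 0 <= f x)%E ->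
  (\int[mu]_y f y = \sum_(0 <= n <oo) \int[mu]_(y in islice n) f y)%E.
Proof.
move=> mf f0; rewrite -[in LHS]islice_cover; apply: ge0_integral_bigcup => //.
- exact: measurable_islice.
- by rewrite islice_cover.
- exact: islice_triv.
Qed.

(** Cauchy-Schwarz on each slice, summed over the slices. *)
Lemma condexp_bound (f : L2) :
  (\int[mu]_y (sqn (cavg f (Num.floor (y : R))))%:E <= (nrm2 f)%:E)%E.
Proof.
have mE : measurable_fun [set: T] (fun y : T => (sqn (cavg f (Num.floor (y : R))))%:E).
  by apply: emeasurable_sqn; exact: floor_cmeasurable.
have mf : measurable_fun [set: T] (fun y : T => (sqn (f y))%:E).
  by apply: emeasurable_sqn; have /inL2P[] := L2P f.
rewrite nrm2E !integral_islice//; last 2 first.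
- by move=> y; rewrite lee_fin sqn_ge0.
- by move=> y; rewrite lee_fin sqn_ge0.
apply: lee_nneseries => [n _ _|n _].
  by apply: integral_ge0 => y _; rewrite lee_fin sqn_ge0.
rewrite /islice; case: pickle_inv => [k|]; last by rewrite !integral_set0.
rewrite int_slice_sqn; apply: le_trans (_ : (sqn (cavg f k))%:E * mu (slice k) <= _)%E.
  rewrite -integral_cst; last exact: measurable_slice.
  rewrite le_eqVlt; apply/orP; left; apply/eqP; apply: eq_integral => y.
  by rewrite inE /slice /= => ->.
by rewrite mu_sliceE -EFinM lee_fin cavg_le.
Qed.

Lemma condexp_inL2 (f : L2) : inL2 mu (fun y : T => cavg f (Num.floor (y : R))).
Proof.
apply/inL2P; split; first exact: floor_cmeasurable.
by apply: le_lt_trans (condexp_bound f) _; rewrite ltry.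
Qed.

Definition condexp (f : L2) : L2 := MkL2 (condexp_inL2 f).

Lemma condexp_lin c f h : condexp (c *: f + h) = c *: condexp f + condexp h.
Proof.
by apply: L2_ext => y /=; rewrite /cavg (hdotDl hdot) (hdotZl hdot) mulrDl mulrA.
Qed.

Lemma nrm2_condexp_le f : nrm2 (condexp f) <= nrm2 f.
Proof. by rewrite -lee_fin nrm2E; exact: condexp_bound. Qed.

Lemma sind_condexp k f : sind k (condexp f) = cavg f k *: sone k.
Proof.
apply: L2_ext => y; rewrite sindE /= rind_sliceE mulrC.
by case: eqP => [->|_]; rewrite ?mulr0.
Qed.

Lemma condexp_sind k f : condexp (sind k f) = sind k (condexp f).
Proof.
apply: L2_ext => y; rewrite sindE /= /cavg dot_sind.
have [<-|ne] := eqVneq (Num.floor (y : R)) k; first by rewrite sind_sone mul1r.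
suff -> : sind k (sone (Num.floor (y : R))) = 0 by rewrite (hdot0r hdot) !mul0r.
apply: L2_ext => x; rewrite sindE /= rind_sliceE -natrM mulnb.
by case: (eqVneq (Num.floor x) k) => // ->; rewrite eq_sym (negbTE ne).
Qed.

Lemma cut_sum (f : L2) n : exists ks : seq int,
  forall y, (\sum_(k <- ks) sind k f) y =
            (pickle (Num.floor (y : R)) < n)%:R * f y.
Proof.
elim: n => [|n [ks IH]]; first by exists [::] => y; rewrite big_nil ltn0 mul0r.
have hn := @pickle_invK int n.
case E : (pickle_inv n) => [k|].
  move: hn; rewrite E /= => hn.
  exists (k :: ks) => y; rewrite big_cons L2DE IH sindE -mulrDl; congr (_ * _).
  rewrite -natrD; set q := pickle _; rewrite (ltnS q n) (leq_eqVlt q n).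
  have [yk|ne] := eqVneq (Num.floor (y : R)) k.
    by rewrite /q yk hn eqxx ltnn.
  rewrite (_ : (q == n) = false)//; apply/negbTE/eqP => e.
  by move/eqP: ne; apply; apply: (pcan_inj pickleK); rewrite hn.
exists ks => y; rewrite IH; set q := pickle _; rewrite (ltnS q n) (leq_eqVlt q n).
rewrite (_ : (q == n) = false)//; apply/negbTE/eqP => e.
by have := pickleK_inv (Num.floor (y : R)); rewrite -/q e E.
Qed.

Lemma sind_dense (f : L2) (eps : R) : 0 < eps -> exists ks : seq int,
  nrm2 (f - \sum_(k <- ks) sind k f) <= eps.
Proof.
move=> e0; pose F n (y : T) : C := (pickle (Num.floor (y : R)) < n)%:R * f y.
have /inL2P[mf ff] := L2P f.
have [N hN] : exists N, forall n, (N <= n)%N ->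
    (\int[mu]_y (sqn (f y - F n y))%:E <= eps%:E)%E.
  apply: (@dominated_sqn _ _ _ mu F f (fun y => sqn (f y))) => //.
  - move=> n; apply: cmeasurableM => //.
    exact: (floor_cmeasurable (fun k => (pickle k < n)%:R)).
  - exact: measurable_sqn.
  - move=> n y; rewrite /F; case: ltnP => _; rewrite ?mul1r ?subrr ?sqn0 ?sqn_ge0//.
    by rewrite mul0r subr0.
  - move=> y; apply: (@cvg_near_cst _ _ _ _ _).
    exists (pickle (Num.floor (y : R))).+1; first exact: Logic.I.
    by move=> n /= hn; rewrite /F hn mul1r subrr sqn0.
have [ks hks] := cut_sum f N; exists ks.
rewrite -lee_fin nrm2E; apply: le_trans (hN N (leqnn _)).
by rewrite le_eqVlt; apply/orP; left; apply/eqP; apply: eq_integral => y _; rewrite L2BE hks.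
Qed.

Lemma condexp0 : condexp 0 = 0.
Proof.
have := condexp_lin (-1) 0 0; rewrite scaler0 addr0 => ->.
by rewrite scaleN1r addNr.
Qed.

Lemma condexpD f h : condexp (f + h) = condexp f + condexp h.
Proof. by have := condexp_lin 1 f h; rewrite !scale1r. Qed.

Lemma dot_condexp_sind k f h : dot (condexp f) (sind k h) = dot f (condexp (sind k h)).
Proof.
rewrite -dot_sind sind_condexp condexp_sind sind_condexp (hdotZl hdot) (hdotZr hdot).
have -> : (cavg h k)^*%C = (dot h (sone k))^*%C / (pslice k)%:C%C.
  by rewrite /cavg rmorphM fmorphV /= oppr0.
by rewrite /cavg (hdotC hdot h); ring.
Qed.

(** The defect of symmetry [D] vanishes on finite sums of slices of h, where it can be computed, and
    is bounded by Cauchy-Schwarz, so it vanishes on their limits. *)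
Lemma dot_condexp f h : dot (condexp f) h = dot f (condexp h).
Proof.
pose D g := dot (condexp f) g - dot f (condexp g).
suff : D h = 0 by move/eqP; rewrite subr_eq0 => /eqP.
apply: sqn_eq0; apply/eqP; rewrite eq_le sqn_ge0 andbT.
have Dle g : sqn (D g) <= 4 * nrm2 f * nrm2 g.
  apply: le_trans (sqnD_le _ _) _; rewrite sqnN.
  have c1 := cauchy_schwarz hdot (condexp f) g.
  have c2 := cauchy_schwarz hdot f (condexp g).
  have d1 : nrm2 (condexp f) * nrm2 g <= nrm2 f * nrm2 g.
    by rewrite ler_wpM2r ?nrm2_condexp_le// (nrm2_ge0 hdot).
  have d2 : nrm2 f * nrm2 (condexp g) <= nrm2 f * nrm2 g.
    by rewrite ler_wpM2l ?nrm2_condexp_le// (nrm2_ge0 hdot).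
  have -> : 4 * nrm2 f * nrm2 g = 2 * (nrm2 f * nrm2 g) + 2 * (nrm2 f * nrm2 g).
    by ring.
  by rewrite lerD// ler_pM2l//; [exact: le_trans c1 d1|exact: le_trans c2 d2].
apply/ler_addgt0Pl => eps e0; rewrite addr0.
have k0 : 0 < 4 * nrm2 f + 1 by have := nrm2_ge0 hdot f; lra.
have [ks hks] := sind_dense h (divr_gt0 e0 k0).
set S := \sum_(k <- ks) sind k h in hks.
have DS : D S = 0.
  rewrite /D /S (big_morph condexp condexpD condexp0) !(hdot_sumr hdot) -sumrB.
  by apply: big1 => k _; rewrite dot_condexp_sind subrr.
have DD g g' : D (g + g') = D g + D g'.
  by rewrite /D condexpD !(hdotDr hdot) opprD addrACA.
have -> : D h = D (h - S) + D S by rewrite -DD subrK.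
rewrite DS addr0; apply: le_trans (Dle _) _.
apply: (@le_trans _ _ ((4 * nrm2 f + 1) * (eps / (4 * nrm2 f + 1)))).
  apply: ler_pM => //; rewrite ?lerDl//; last exact: (nrm2_ge0 hdot).
  by rewrite mulr_ge0// (nrm2_ge0 hdot).
by rewrite mulrC divfK// gt_eqF.
Qed.

Lemma condexp_idem f : condexp (condexp f) = condexp f.
Proof.
apply: L2_ext => y /=; set k := Num.floor _.
rewrite /cavg -(sind_sone k) -dot_sind sind_condexp (hdotZl hdot) dot_sone sind_sone /cavg.
have [p0|p0] := eqVneq (pslice k) 0; first by rewrite p0 rmorph0 invr0 !mulr0.
by field; rewrite -(rmorph0 (real_complex R)) (inj_eq (@complexI R)).
Qed.

Lemma nrm2_subr_condexp f : nrm2 (f - condexp f) = nrm2 f - nrm2 (condexp f).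
Proof.
rewrite (nrm2B hdot).
have -> : dot f (condexp f) = dot (condexp f) (condexp f).
  by rewrite -{1}condexp_idem dot_condexp.
by rewrite /nrm2; ring.
Qed.

End condexp.

Section slicewise.
Context {R : realType}.
Local Notation T := (measurableTypeR R).
Local Notation C := R[i].
Variable mu : probability T R.
Hypothesis mu_singular : mutually_singular (@lebesgue_measure R) mu.
Local Notation L2 := (L2 mu).
Local Notation dot := (@dot _ T R mu).
Local Notation nrm2 := (nrm2 dot).
Let hdot : pos_hermitian dot := L2_pos_hermitian mu.
Let zm : cmeasurable (@ez R) := ez_cmeasurable.

Lemma unit_le1 d (T' : measurableType d) (g : T' -> C) :
  (forall x, sqn (g x) = 1) -> forall x, sqn (g x) <= 1.
Proof. by move=> g1 x; rewrite g1. Qed.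

Let z1le := unit_le1 (@sqn_ez R).
Let zJ1 (y : T) : sqn (ez y)^*%C = 1. Proof. by rewrite sqnJ sqn_ez. Qed.
Let zJm : cmeasurable (fun y : T => (ez y)^*%C) := cmeasurableJ zm.

Definition mulz : L2 -> L2 := L2mul zm z1le.
Definition mulzJ : L2 -> L2 := L2mul zJm (unit_le1 zJ1).

Lemma mulzJE f y : mulzJ f y = (ez y)^*%C * f y. Proof. by []. Qed.

Lemma nrm2_mulzJ f : nrm2 (mulzJ f) = nrm2 f.
Proof. exact: nrm2_L2mul. Qed.

Lemma dot_mulzJ f h : dot (mulzJ f) h = dot f (mulz h).
Proof. by apply: dot_L2mul => x; rewrite conjcK. Qed.

Definition resid (f : L2) : L2 := mulzJ (f - condexp f).

Lemma resid_lin c f h : resid (c *: f + h) = c *: resid f + resid h.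
Proof.
rewrite /resid -L2mul_lin; congr L2mul.
by rewrite condexp_lin opprD addrACA scalerBr.
Qed.

Lemma nrm2_resid f : nrm2 (resid f) = nrm2 f - nrm2 (condexp f).
Proof. by rewrite nrm2_mulzJ nrm2_subr_condexp. Qed.

Lemma resid_contr f : nrm2 (resid f) <= nrm2 f.
Proof. by rewrite nrm2_resid gerBl (nrm2_ge0 hdot). Qed.

(** Allows the intervals to be studied one at a time. *)
Lemma resid_sind k f : resid (sind k f) = sind k (resid f).
Proof.
rewrite /resid condexp_sind; apply: L2_ext => y.
rewrite sindE /mulzJ /= rind_sliceE; ring.
Qed.

Section one_slice.
Variable k : int.
Hypothesis p0 : pslice mu k != 0.

Let pp : 0 < pslice mu k. Proof. by rewrite lt_neqAle eq_sym p0 pslice_ge0. Qed.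

Let s : R := (Num.sqrt (pslice mu k))^-1.

Let s0 : 0 < s. Proof. by rewrite invr_gt0 sqrtr_gt0. Qed.
Let s2 : s ^+ 2 = (pslice mu k)^-1.
Proof. by rewrite exprVn sqr_sqrtr// ltW. Qed.

Definition sunit : L2 := s%:C%C *: sone mu k.

Lemma sunitE y : sunit y = s%:C%C * (Num.floor (y : R) == k)%:R.
Proof. by rewrite -rind_sliceE. Qed.

Lemma sunit_dot : dot sunit sunit = 1.
Proof.
rewrite (hdotZl hdot) (hdotZr hdot) conjc_real dot_sone mulrA -!rmorphM /=.
by rewrite -expr2 s2 mulVf.
Qed.

Lemma dot_sunit_sind f : dot (sind k f) sunit *: sunit = cavg f k *: sone mu k.
Proof.
rewrite /sunit (hdotZr hdot) conjc_real dot_sind sind_sone scalerA; congr (_ *: _).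
rewrite /cavg mulrAC -rmorphM -expr2 s2 mulrC; congr (_ * _).
by rewrite fmorphV.
Qed.

Lemma kacz_resid f : kacz dot sunit mulzJ (sind k f) = resid (sind k f).
Proof. by rewrite /kacz dot_sunit_sind /resid condexp_sind sind_condexp. Qed.

(** On functions supported by slice k the conditional expectation is the projection on the line of
    [sunit], and [resid] keeps such a support, so the agreement persists under iteration. *)
Lemma iter_kacz_resid N f :
  iter N (kacz dot sunit mulzJ) (sind k f) = iter N resid (sind k f).
Proof.
have H M : exists g, iter M resid (sind k f) = sind k g.
  elim: M => [|M [g IH]]; first by exists f.
  by exists (resid g); rewrite iterS IH resid_sind.
elim: N => //= N ->; have [g ->] := H N; exact: kacz_resid.
Qed.

Lemma zl_le1 (l : int) (y : T) : sqn (ez y ^ l) <= 1.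
Proof. by rewrite sqn_exprz// sqn_ez. Qed.

Let zlm (l : int) : cmeasurable (fun y : T => ez y ^ l) :=
  exprz_cmeasurable l zm (@sqn_ez R).

Definition vz (l : int) : L2 := L2mul (zlm l) (zl_le1 l) sunit.

Lemma vzE l y : vz l y = ez y ^ l * (s%:C%C * (Num.floor (y : R) == k)%:R).
Proof. by rewrite -rind_sliceE. Qed.

Lemma realpart_vz P y : realpart vz P y =
  (complex.Re (laurent P (ez y)))%:C%C * (s%:C%C * (Num.floor (y : R) == k)%:R).
Proof.
have -> : (complex.Re (laurent P (ez y)))%:C%C =
    \sum_(t <- P) (complex.Re (t.1 * ez y ^ t.2))%:C%C.
  by rewrite /laurent (raddf_sum (@complex.Re R)) /= rmorph_sum.
rewrite /realpart L2sumE mulr_suml; apply: eq_bigr => t _.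
rewrite L2DE !L2ZE !vzE ReJ_add rmorphM /= unit_exprzJ ?sqn_ez//.
by rewrite !mulrA -mulrDl -mulrDl; congr (_ * _); congr (_ * _); ring.
Qed.

Lemma sum_vz P y : (\sum_(t <- P) t.1 *: vz t.2) y =
  laurent P (ez y) * (s%:C%C * (Num.floor (y : R) == k)%:R).
Proof.
rewrite L2sumE /laurent mulr_suml; apply: eq_bigr => t _.
by rewrite L2ZE vzE -[RHS]mulrA.
Qed.

Lemma nrm2_slice (f : L2) (g : T -> C) (c : R) : cmeasurable g ->
  (forall y, f y = g y * (c%:C%C * (Num.floor (y : R) == k)%:R)) ->
  ((nrm2 f)%:E = (c ^+ 2)%:E *
    \int[mrestr mu (measurable_slice k)]_y (sqn (g y))%:E)%E.
Proof.
move=> gm fg; rewrite nrm2E integral_mrestr; last exact: emeasurable_sqn.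
rewrite [X in (_ * X)%E]integral_mkcond -ge0_integralZl//=.
- apply: eq_integral => y _; rewrite fg patchE.
  case: ifPn => [|/negP h].
    by rewrite inE /slice /= => ->; rewrite eqxx mulr1 sqnM sqnR -EFinM mulrC.
  case: eqP => [e|_]; first by exfalso; apply: h; rewrite inE.
  by rewrite !mulr0 sqn0 mule0.
- apply/(measurable_restrictT _ (measurable_slice k)); apply: measurable_funTS.
  exact: emeasurable_sqn.
- by move=> y _; apply: erestrict_ge0 => x _; rewrite lee_fin sqn_ge0.
- by rewrite lee_fin sqr_ge0.
Qed.

(** The abstract theorem for multiplication by e^(2 pi i y), the unit vector being the normalised
    indicator of the slice, and Lebesgue measure on the same slice playing the circle. *)
Lemma stable_sind f : stable dot resid (sind k f).
Proof.
have H : stable dot (kacz dot sunit mulzJ) (sind k f); last first.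
  by move=> eps e0; have [N hN] := H _ e0; exists N; rewrite -iter_kacz_resid.
apply: (@kacz_stable R L2 dot hdot sunit mulzJ sunit_dot _ nrm2_mulzJ vz _ _ _
  _ _ (leb_slice k) ez zm (@sqn_ez R) (leb_slice1 k) (ez_orthonormal k)).
- exact: L2mul_lin.
- by apply: L2_ext => y; rewrite vzE expr0z mul1r /= rind_sliceE.
- move=> l; apply: L2_ext => y; rewrite mulzJE !vzE unit_exprzS ?sqn_ez//.
  by rewrite mulrA [X in X * _]mulrA mulJc sqn_ez mul1r.
- move=> l; rewrite -(hdotC hdot); apply: dot_L2mul => y.
  by rewrite unit_exprzJ ?sqn_ez// opprK.
(* The second member pays for the factor s^2 = 1 / pslice that [sunit] brings into the norm. *)
- move=> eps e0; have e1 : 0 < Num.min eps (eps * pslice mu k).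
    by rewrite lt_min e0 mulr_gt0.
  have [P [h1 h2]] := slice_singular k mu_singular e1; exists P; split.
    by apply: le_trans h1 _; rewrite lee_fin ge_min lexx.
  have mP : cmeasurable (fun y : T => laurent P (ez y)).
    exact: laurent_cmeasurable P zm (@sqn_ez R).
  have mg : cmeasurable (fun y : T => (1 - complex.Re (laurent P (ez y)))%:C%C).
    by apply: cmeasurable_real; apply: measurable_funB => //; case: mP.
  rewrite -lee_fin (nrm2_slice (c := s) mg).
    have -> : eps%:E = ((s ^+ 2)%:E * (eps * pslice mu k)%:E)%E.
      by rewrite -EFinM s2; congr EFin; field.
    rewrite lee_wpmul2l ?lee_fin ?sqr_ge0//.
    under eq_integral do rewrite sqnR.
    by apply: le_trans h2 _; rewrite lee_fin ge_min lexx orbT.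
  by move=> y; rewrite L2BE realpart_vz sunitE rmorphB rmorph1 mulrBl mul1r.
- move=> eps e0; have [P hP] := slice_dense k (L2P f) e0.
  (* The factor 1 / s undoes the normalisation of [sunit]. *)
  exists [seq ((s^-1)%:C%C * t.1, t.2) | t <- P].
  have mP : cmeasurable (fun y : T => laurent P (ez y)).
    exact: laurent_cmeasurable P zm (@sqn_ez R).
  have mg : cmeasurable (fun y => f y - laurent P (ez y)).
    apply: cmeasurableD; last exact: cmeasurableN.
    by have /inL2P[] := L2P f.
  rewrite -lee_fin (nrm2_slice (c := 1) mg) ?expr1n ?mul1e//.
  move=> y; rewrite L2BE sum_vz sindE mul1r mulrBl [_ * f y]mulrC; congr (_ - _).
  rewrite mulrA; congr (_ * _).
  rewrite /laurent big_map /= mulr_suml; apply: eq_bigr => t _ /=.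
  by rewrite fmorphV; field; rewrite -(rmorph0 (real_complex R)) (inj_eq (@complexI R)) gt_eqF.
Qed.

End one_slice.

Theorem stable_resid f : stable dot resid f.
Proof.
apply: (stable_closed hdot resid_lin resid_contr) => eps e0.
have [ks hks] := sind_dense f e0; exists (\sum_(k <- ks) sind k f) => //.
apply: (stable_sum hdot resid_lin resid_contr) => k _.
have [p0|p0] := eqVneq (pslice mu k) 0; last exact: stable_sind.
(* A null slice has no unit vector, but the restriction of f to it has norm 0 from the start. *)
move=> e e'0; exists 0%N => /=; apply: le_trans (ltW e'0).
have h : (nrm2 (sind k f))%:E = 0%E.
  rewrite -int_slice_sqn; apply: null_set_integral => //.
  - exact: measurable_slice.
  - apply: measurable_funTS; apply: emeasurable_sqn.
    by have /inL2P[] := L2P f.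
  - by have := mu_sliceE mu k; rewrite p0.
by move: h => [->].
Qed.

End slicewise.

(** * Functions of the integer part *)

Section integer_characters.
Context {R : realType}.
Local Notation T := (measurableTypeR R).
Local Notation C := R[i].

Lemma expi_eq1_itv (x : R) : 0 <= x -> x < 2 * pi -> expi x = 1 -> x = 0.
Proof.
move=> x0 x1 [cx _]; have pi0 := pi_gt0 R.
have inj (u : R) : 0 <= u -> u <= pi -> cos u = 1 -> u = 0.
  move=> u0 u1 cu; apply: cos_inj; rewrite ?cos0//; rewrite in_itv /= ?lexx ?u0//.
  exact: ltW.
have [xp|xp] := lerP x pi; first exact: inj.
have h : 2 * pi - x = 0.
  apply: inj; [lra|lra|].
  have -> : 2 * pi - x = - x + pi *+ 2 by rewrite -mulr_natl; ring.
  by rewrite cosD2pi cosN.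
lra.
Qed.

(** Reducing m modulo 2 pi gives m = 2 pi n. If m were nonzero, n would be nonzero too, and pi = m /
    (2 n) would be rational. *)
Lemma expi_int_eq1 (m : int) : expi (m%:~R : R) = 1 -> m = 0.
Proof.
move=> hm; apply/eqP; apply: contraT => m0; exfalso.
have pi0 := pi_gt0 R; have p2 : 0 < 2 * pi :> R by rewrite mulr_gt0.
pose t : R := m%:~R / (2 * pi); pose n := Num.floor t.
have /andP[nt tn] := floor_itv t.
pose r : R := m%:~R - 2 * pi * n%:~R.
have tE : 2 * pi * t = m%:~R by rewrite mulrC divfK// gt_eqF.
have r0 : 0 <= r by rewrite subr_ge0 -tE ler_pM2l.
have r1 : r < 2 * pi.
  have -> : 2 * pi = 2 * pi * (n%:~R + 1) - 2 * pi * n%:~R :> R by ring.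
  by rewrite ltrD2r -tE ltr_pM2l//; move: tn; rewrite intrD.
have hr : expi r = 1 by rewrite expiD hm expiN expi_2pi_int conjc1 mulr1.
have := expi_eq1_itv r0 r1 hr => /eqP; rewrite subr_eq0 => /eqP mE.
have n0 : n != 0.
  by apply/eqP => n0; move/eqP: m0; apply; apply: (@intr_inj R); rewrite mE n0 mulr0.
apply: (@pi_irrationnal R); apply/rationalP.
have n0' : n%:~R != 0 :> R by rewrite intr_eq0.
have piE : pi = m%:~R / (2 * n%:~R) :> R by rewrite mE; field.
move: piE n0'; case: (n) => k piE n0'.
  by exists m, (2 * k)%N; rewrite piE natrM.
exists (- m), (2 * k.+1)%N; rewrite piE natrM NegzE !mulrNz -pmulrn.
by rewrite mulrN invrN mulrN mulNr.
Qed.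

End integer_characters.

Section dirichlet_mean.
Context {R : realType}.
Local Notation C := R[i].

Lemma sqn_geometric_le (a : C) N : sqn a = 1 ->
  sqn (\sum_(j < N) a ^+ j) <= N%:R ^+ 2.
Proof.
move=> a1; have na : `|a| = 1.
  apply/eqP; rewrite -(@eqrXn2 _ 2)// ?expr1n -?add_Re2_Im2 -/(sqn a) ?a1//.
rewrite -lecR /sqn add_Re2_Im2 rmorphXn /= rmorph_nat.
rewrite lerXn2r ?nnegrE//.
apply: le_trans (ler_norm_sum _ _ _) _.
by under eq_bigr do rewrite normrX na expr1n; rewrite sumr_const card_ord.
Qed.

Lemma sqn_geometric_neq1 (a : C) N : sqn a = 1 ->
  sqn (1 - a) * sqn (\sum_(j < N) a ^+ j) <= 4.
Proof.
move=> a1; rewrite -sqnM -opprB mulNr sqnN -subrX1.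
by apply: sqnB_le4; rewrite ?sqn1// sqnX a1 expr1n.
Qed.

(** The Cesaro mean of the powers of a, with N + 1 terms so that the divisor is never 0. For |a| = 1
    it stays in the unit disc and tends to 1 if a = 1, to 0 otherwise. *)
Definition dmean (a : C) (N : nat) : C := (N.+1%:R)^-1 * \sum_(j < N.+1) a ^+ j.

Lemma sqn_natV n : sqn (n%:R^-1 : C) = (n%:R ^+ 2)^-1.
Proof. by rewrite -(rmorph_nat (real_complex R)) -fmorphV sqnR exprVn. Qed.

Lemma sqn_dmean_le1 a N : sqn a = 1 -> sqn (dmean a N) <= 1.
Proof.
move=> a1; rewrite sqnM sqn_natV mulrC ler_pdivrMr ?mul1r ?exprn_gt0//.
exact: sqn_geometric_le.
Qed.

Lemma dmean1 N : dmean 1 N = 1.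
Proof.
rewrite /dmean; under eq_bigr do rewrite expr1n.
by rewrite sumr_const card_ord mulVf// pnatr_eq0.
Qed.

Lemma dmean_cvg0 a : sqn a = 1 -> a != 1 ->
  (fun N => sqn (dmean a N)) @ \oo --> (0 : R).
Proof.
move=> a1 an1; have d0 : 0 < sqn (1 - a).
  rewrite lt_neqAle sqn_ge0 andbT eq_sym; apply: contra an1 => /eqP/sqn_eq0/eqP.
  by rewrite subr_eq0 eq_sym.
(* The summand with coefficient 0 only gives the bound the shape expected by [cvg0_lin]. *)
apply: (@squeeze_cvgr _ _ _ _ (fun=> 0) 
  (fun N => 4 / sqn (1 - a) * (N.+1%:R^-1) + 0 * (N.+1%:R)^-1));
  [|exact: cvg_cst|by apply: cvg0_lin; exact: cvg_harmonic].
apply: nearW => N; rewrite sqn_ge0 /= mul0r addr0 sqnM sqn_natV.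
have N1 : 1 <= N.+1%:R :> R by rewrite ler1n.
have N0 : 0 < N.+1%:R :> R by rewrite ltr0n.
have h := sqn_geometric_neq1 N.+1 a1.
rewrite mulrC; apply: ler_pM; rewrite ?sqn_ge0 ?invr_ge0 ?sqr_ge0//.
  by rewrite ler_pdivlMr// mulrC.
rewrite lef_pV2 ?posrE ?exprn_gt0// expr2 ler_peMr// ltW.
Qed.

End dirichlet_mean.

Section discrete.
Context {R : realType}.
Local Notation T := (measurableTypeR R).
Local Notation C := R[i].
Variable mu : probability T R.
Local Notation L2 := (L2 mu).
Local Notation dot := (@dot _ T R mu).
Local Notation nrm2 := (nrm2 dot).
Let hdot : pos_hermitian dot := L2_pos_hermitian mu.

Definition ef (y : T) : C := expi (Num.floor (y : R))%:~R.

Lemma sqn_ef y : sqn (ef y) = 1. Proof. exact: sqn_expi. Qed.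

Lemma ef_cmeasurable : cmeasurable ef.
Proof. exact: (floor_cmeasurable (fun k : int => expi (k%:~R : R))). Qed.

Let wm := ef_cmeasurable.
Let w1le := unit_le1 sqn_ef.
Let wJ1 (y : T) : sqn (ef y)^*%C = 1. Proof. by rewrite sqnJ sqn_ef. Qed.
Let wJm : cmeasurable (fun y : T => (ef y)^*%C) := cmeasurableJ wm.

Definition mulw : L2 -> L2 := L2mul wm w1le.
Definition mulwJ : L2 -> L2 := L2mul wJm (unit_le1 wJ1).

Lemma mulwJE f y : mulwJ f y = (ef y)^*%C * f y. Proof. by []. Qed.

Lemma nrm2_mulwJ f : nrm2 (mulwJ f) = nrm2 f.
Proof. exact: nrm2_L2mul. Qed.

Lemma dot_mulwJ f h : dot (mulwJ f) h = dot f (mulw h).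
Proof. by apply: dot_L2mul => x; rewrite conjcK. Qed.

Lemma one_inL2 : inL2 mu (fun _ : T => 1 : C).
Proof.
apply: (@inL2_bounded _ _ _ mu _ 1); first exact: mu_fin.
  exact: cmeasurable_cst.
by move=> x; rewrite sqn1.
Qed.

Definition one2 : L2 := MkL2 one_inL2.

Lemma dot_one2 : dot one2 one2 = 1.
Proof.
rewrite (hdotff hdot) -(rmorph1 (real_complex R)); congr (_%:C%C).
apply: EFin_inj; rewrite nrm2E; under eq_integral do rewrite /= sqn1.
rewrite (integral_cst mu measurableT 1%:E) mul1e; exact: probability_setT.
Qed.

Let wlm (l : int) : cmeasurable (fun y : T => ef y ^ l) :=
  exprz_cmeasurable l wm sqn_ef.

Lemma vw_inL2 (l : int) : inL2 mu (fun y : T => ef y ^ l).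
Proof.
apply: (@inL2_bounded _ _ _ mu _ 1); [exact: mu_fin|exact: wlm|].
by move=> y; rewrite sqn_exprz ?sqn_ef.
Qed.

Definition vw (l : int) : L2 := MkL2 (vw_inL2 l).

Lemma vwE l y : vw l y = ef y ^ l. Proof. by []. Qed.

Lemma realpart_vw P y : realpart vw P y = (complex.Re (laurent P (ef y)))%:C%C.
Proof.
have -> : (complex.Re (laurent P (ef y)))%:C%C =
    \sum_(t <- P) (complex.Re (t.1 * ef y ^ t.2))%:C%C.
  by rewrite /laurent (raddf_sum (@complex.Re R)) /= rmorph_sum.
rewrite /realpart L2sumE; apply: eq_bigr => t _.
rewrite L2DE !L2ZE !vwE ReJ_add rmorphM /= unit_exprzJ ?sqn_ef//; ring.
Qed.

Definition lvw (P : seq (C * int)) : L2 := \sum_(t <- P) t.1 *: vw t.2.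

Lemma lvwE P y : lvw P y = laurent P (ef y).
Proof. by rewrite /lvw L2sumE; apply: eq_bigr => t _. Qed.

(** The Cesaro mean at e^(-ik) z, which isolates the point z = e^(ik) as N grows. *)
Definition dpoly (k : int) (N : nat) : seq (C * int) :=
  [seq ((N.+1%:R)^-1 * (expi (k%:~R : R))^*%C ^+ j, j%:Z) | j <- iota 0 N.+1].

Lemma laurent_dpoly k N z :
  laurent (dpoly k N) z = dmean ((expi (k%:~R : R))^*%C * z) N.
Proof.
rewrite /laurent big_map /dmean mulr_sumr -(big_mkord xpredT
  (fun j => (N.+1%:R)^-1 * ((expi (k%:~R : R))^*%C * z) ^+ j)).
by rewrite /index_iota subn0; apply: eq_bigr => j _ /=; rewrite exprMn mulrA.
Qed.

Let lam := leb_slice (R := R) 0.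

(** There are N + 1 coefficients, each of squared modulus 1 / (N + 1)^2. *)
Lemma int_dpoly k N :
  (\int[lam]_y (sqn (laurent (dpoly k N) (ez y)))%:E = (N.+1%:R^-1)%:E)%E.
Proof.
under eq_integral => y _.
  rewrite laurent_dpoly /dmean mulr_sumr.
  under eq_bigr do rewrite exprMn mulrA.
  over.
rewrite (mean_power_sum (fun j => (N.+1%:R)^-1 * (expi (k%:~R : R))^*%C ^+ j)
  _ ez_cmeasurable (@sqn_ez R) (leb_slice1 0) (ez_orthonormal 0)).
congr EFin; under eq_bigr do rewrite sqnM sqnX sqnJ sqn_expi expr1n mulr1 sqn_natV.
by rewrite sumr_const card_ord -[LHS]mulr_natr expr2 invfM -mulrA mulVf ?mulr1 ?pnatr_eq0.
Qed.

(** Evaluated at e^(i floor(y)), the mean tends to the indicator of slice k, because e^(ij) = 1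
    forces j = 0; its Lebesgue norm tends to 0 at the same time, so one large N serves both. *)
Lemma sone_approx k (eps : R) : 0 < eps -> exists P : seq (C * int),
  (\int[lam]_y (sqn (laurent P (ez y)))%:E <= eps%:E)%E /\
  nrm2 (sone mu k - lvw P) <= eps.
Proof.
move=> e0.
pose a (y : T) : C := (expi (k%:~R : R))^*%C * ef y.
have a1 y : sqn (a y) = 1 by rewrite sqnM sqnJ sqn_ef sqn_expi mulr1.
have [N1 hN1] : exists N, forall n, (N <= n)%N ->
    (\int[mu]_y (sqn (sone mu k y - laurent (dpoly k n) (ef y)))%:E <= eps%:E)%E.
  apply: (@dominated_sqn _ _ _ mu (fun n y => laurent (dpoly k n) (ef y)) _ (cst 4)) => //.
  - by move=> n; exact: laurent_cmeasurable _ wm sqn_ef.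
  - exact: rind_cmeasurable (measurable_slice k).
  - exact: (int_cst_lty (mu_fin mu)).
  - move=> n y; apply: sqnB_le4; first exact: rind_le1.
    by rewrite laurent_dpoly; apply: sqn_dmean_le1; exact: a1.
  - move=> y; under eq_fun => n do rewrite /= rind_sliceE laurent_dpoly -/(a y).
    have [yk|yk] := eqVneq (Num.floor (y : R)) k.
      have -> : a y = 1 by rewrite /a /ef yk mulJc sqn_expi.
      by under eq_fun do rewrite dmean1 subrr sqn0; exact: cvg_cst.
    under eq_fun do rewrite sub0r sqnN.
    apply: dmean_cvg0 => //; apply: contra yk => /eqP h.
    rewrite -subr_eq0; apply/eqP; apply: (@expi_int_eq1 R).
    by rewrite intrB expiD expiN mulrC.
have [N2 _ hN2] : \forall n \near \oo, (n.+1%:R^-1 : R) <= eps.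
  have /cvgrPdist_le/(_ _ e0) := @cvg_harmonic R; apply: filterS => n.
  by rewrite sub0r normrN; exact: le_trans (ler_norm _).
exists (dpoly k (maxn N1 N2)); split.
  by rewrite int_dpoly lee_fin; apply: hN2 => /=; exact: leq_maxr.
rewrite -lee_fin nrm2E; apply: le_trans (hN1 _ (leq_maxl N1 N2)).
by rewrite le_eqVlt; apply/orP; left; apply/eqP; apply: eq_integral => y _; rewrite L2BE lvwE.
Qed.

Lemma sones_approx (ks : seq int) (eps : R) : 0 < eps -> exists P : seq (C * int),
  (\int[lam]_y (sqn (laurent P (ez y)))%:E <= eps%:E)%E /\
  nrm2 (\sum_(k <- ks) sone mu k - lvw P) <= eps.
Proof.
elim: ks eps => [|k ks IH] eps e0.
  exists [::]; split; last by rewrite big_nil /lvw big_nil subr0 (nrm20 hdot) ltW.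
  under eq_integral do rewrite /laurent big_nil sqn0.
  by rewrite integral0 lee_fin ltW.
have e4 : 0 < eps / 4 by lra.
have [P [P1 P2]] := IH _ e4; have [Q [Q1 Q2]] := sone_approx k e4.
exists (Q ++ P); split.
  under eq_integral do rewrite laurent_cat.
  have -> : eps = 2 * (eps / 4) + 2 * (eps / 4) by field.
  by apply: int_sqnD_le => //; exact: laurent_cmeasurable _ ez_cmeasurable (@sqn_ez R).
rewrite big_cons /lvw big_cat /= opprD addrACA -/(lvw P) -/(lvw Q).
apply: le_trans (nrm2D_le hdot _ _) _.
have -> : eps = 2 * (eps / 4) + 2 * (eps / 4) by field.
by rewrite lerD// ler_pM2l.
Qed.

(** Finitely many slices carry almost all of mu, and the sum of their indicators is approximated
    slice by slice. Taking the real part increases neither error, since 1 is real. *)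
Lemma one2_approx (eps : R) : 0 < eps -> exists P : seq (C * int),
  (\int[lam]_y ((complex.Re (laurent P (ez y))) ^+ 2)%:E <= eps%:E)%E /\
  nrm2 (one2 - realpart vw P) <= eps.
Proof.
move=> e0; have e4 : 0 < eps / 4 by lra.
have [ks hks] := sind_dense one2 e4; have [P [P1 P2]] := sones_approx ks e4.
have mP : cmeasurable (fun y : T => laurent P (ez y)).
  exact: laurent_cmeasurable P ez_cmeasurable (@sqn_ez R).
exists P; split.
  apply: (@le_trans _ _ (\int[lam]_y (sqn (laurent P (ez y)))%:E)%E).
    apply: ge0_le_integral => //.
    - by move=> y _; rewrite lee_fin sqr_ge0.
    - by apply/measurable_EFinP; apply: measurable_funX; case: mP.
    - exact: emeasurable_sqn.
    - by move=> y _; rewrite lee_fin Re_sq_le.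
  by apply: le_trans P1 _; rewrite lee_fin; lra.
apply: (@le_trans _ _ (nrm2 (one2 - lvw P))).
  rewrite -lee_fin !nrm2E; apply: ge0_le_integral => //.
  - by move=> y _; rewrite lee_fin sqn_ge0.
  - by apply: emeasurable_sqn; have /inL2P[] := L2P (one2 - realpart vw P).
  - by apply: emeasurable_sqn; have /inL2P[] := L2P (one2 - lvw P).
  - move=> y _; rewrite lee_fin !L2BE realpart_vw lvwE.
    have -> (r : R) : one2 y - r%:C%C = (1 - r)%:C%C by rewrite rmorphB rmorph1.
    rewrite sqnR.
    by apply: le_trans (Re_sq_le _); rewrite cReD (raddfN (@complex.Re R)).
have -> : one2 - lvw P = (one2 - \sum_(k <- ks) sind k one2)
    + (\sum_(k <- ks) sone mu k - lvw P).
  have -> : \sum_(k <- ks) sind k one2 = \sum_(k <- ks) sone mu k.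
    by apply: eq_bigr => k _; apply: L2_ext => y; rewrite /= mulr1.
  by rewrite addrA subrK.
apply: le_trans (nrm2D_le hdot _ _) _.
have -> : eps = 2 * (eps / 4) + 2 * (eps / 4) by field.
by rewrite lerD// ler_pM2l.
Qed.

Definition kaczw : L2 -> L2 := kacz dot one2 mulwJ.

Let mulwJ_lin c f h : mulwJ (c *: f + h) = c *: mulwJ f + mulwJ h.
Proof. exact: L2mul_lin. Qed.

Lemma kaczw_lin c f h : kaczw (c *: f + h) = c *: kaczw f + kaczw h.
Proof. exact: (kacz_lin hdot). Qed.

Lemma kaczw_contr f : nrm2 (kaczw f) <= nrm2 f.
Proof. exact: (kacz_contr hdot dot_one2 nrm2_mulwJ). Qed.

(** Two variables are at work: [lam] with [ez] represents Lebesgue measure on the circle, while in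
    L^2(mu) the polynomials are evaluated at [ef]. *)
Lemma stable_sone k : stable dot kaczw (sone mu k).
Proof.
apply: (@kacz_stable R L2 dot hdot one2 mulwJ dot_one2 mulwJ_lin nrm2_mulwJ vw _ _ _
  _ _ lam ez ez_cmeasurable (@sqn_ez R) (leb_slice1 0) (ez_orthonormal 0)).
- by apply: L2_ext => y; rewrite vwE expr0z.
- move=> l; apply: L2_ext => y; rewrite mulwJE !vwE unit_exprzS ?sqn_ef//.
  by rewrite mulrA mulJc sqn_ef mul1r.
- move=> l; rewrite -(hdotC hdot); apply: dot_ext => y.
  have -> : one2 y = 1 by [].
  by rewrite !vwE conjc1 mulr1 mul1r unit_exprzJ ?sqn_ef.
- exact: one2_approx.
- by move=> eps e0; have [P [_ hP]] := sone_approx k e0; exists P.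
Qed.

Theorem stable_kaczw f : stable dot kaczw (condexp f).
Proof.
apply: (stable_closed hdot kaczw_lin kaczw_contr) => eps e0.
have [ks hks] := sind_dense (condexp f) e0.
exists (\sum_(k <- ks) sind k (condexp f)) => //.
apply: (stable_sum hdot kaczw_lin kaczw_contr) => k _.
rewrite sind_condexp; apply: (stableZ hdot kaczw_lin); exact: stable_sone.
Qed.

End discrete.

Lemma dot_iter_adjoint {R : realType} {V : lmodType R[i]} (dot : V -> V -> R[i])
    (A B : V -> V) (AB : forall f h, dot (A f) h = dot f (B h)) n f h :
  dot (iter n A f) h = dot f (iter n B h).
Proof. by elim: n f h => // n IH f h; rewrite iterS AB IH -iterSr. Qed.

Lemma stable_cvg {R : realType} {V : lmodType R[i]} (dot : V -> V -> R[i])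
    (A : V -> V) f : pos_hermitian dot -> (forall g, nrm2 dot (A g) <= nrm2 dot g) ->
  stable dot A f -> (fun N => nrm2 dot (iter N A f)) @ \oo --> (0 : R).
Proof.
move=> hdot Ac sf; apply/cvgrPdist_le => eps e0.
have [N hN] := stable_ge Ac sf e0; exists N => // M /= NM.
by rewrite sub0r normrN ger0_norm ?(nrm2_ge0 hdot)// hN.
Qed.

Lemma esum_cvg {R : realType} (a : nat -> R) (l : R) : (forall k, 0 <= a k) ->
  (fun N => \sum_(k < N) a k) @ \oo --> l ->
  (\esum_(k in [set: nat]) (a k)%:E = l%:E)%E.
Proof.
move=> a0 al; rewrite -nneseries_esumT; last by move=> n; rewrite lee_fin.
apply/cvg_lim => //; under eq_fun do rewrite sumEFin big_mkord.
by apply: cvg_EFin; first exact: nearW.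
Qed.

(** * The frame *)

Section main.
Context {R : realType}.
Local Notation T := (measurableTypeR R).
Local Notation C := R[i].
Variable mu : probability T R.
Hypothesis mu_singular : mutually_singular (@lebesgue_measure R) mu.
Local Notation L2 := (L2 mu).
Local Notation dot := (@dot _ T R mu).
Local Notation nrm2 := (nrm2 dot).
Let hdot : pos_hermitian dot := L2_pos_hermitian mu.
Local Notation one2 := (one2 mu).
Local Notation bcoef := (coef dot one2 (@mulwJ R mu)).

Definition resid_adj (h : L2) : L2 := mulz h - condexp (mulz h).

Lemma dot_resid f h : dot (resid f) h = dot f (resid_adj h).
Proof.
by rewrite dot_mulzJ (hdotBl hdot) dot_condexp -(hdotBr hdot).
Qed.

Definition kaczw_adj (h : L2) : L2 := mulw h - dot (mulw h) one2 *: one2.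

Lemma dot_kaczw f h : dot (kaczw f) h = dot f (kaczw_adj h).
Proof.
rewrite dot_mulwJ (hdotBl hdot) (hdotZl hdot) (hdotBr hdot) (hdotZr hdot).
by rewrite -(hdotC hdot) mulrC.
Qed.

(** The coefficient <f, c_nm> should come from applying [resid] n times, then the conditional
    expectation, then [kaczw] m times, and pairing with 1. Taking adjoints reverses the order; the
    conditional expectation is its own adjoint. *)
Definition cframe (n m : nat) : L2 :=
  iter n resid_adj (condexp (iter m kaczw_adj one2)).

Definition slice_coef (f : L2) (n : nat) : L2 := condexp (iter n (@resid R mu) f).

Lemma dot_cframe f n m : dot f (cframe n m) = bcoef (slice_coef f n) m.
Proof.
rewrite -(dot_iter_adjoint dot_resid) -dot_condexp.
by rewrite -(dot_iter_adjoint dot_kaczw).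
Qed.

Lemma resid_energy f N : nrm2 f =
  nrm2 (iter N (@resid R mu) f) + \sum_(n < N) nrm2 (slice_coef f n).
Proof.
elim: N => [|N IH]; first by rewrite big_ord0 addr0.
by rewrite big_ord_recr /= nrm2_resid [X in _ + X]addrC addrA subrK.
Qed.

Lemma sum_slice_coef f :
  (fun N => \sum_(n < N) nrm2 (slice_coef f n)) @ \oo --> nrm2 f.
Proof.
have E : (fun N => \sum_(n < N) nrm2 (slice_coef f n)) =
    (fun N => nrm2 f - nrm2 (iter N (@resid R mu) f)).
  by apply/funext => N; rewrite (resid_energy f N) addrC addKr.
rewrite E -[X in _ --> X]subr0; apply: cvgB; first exact: cvg_cst.
exact: (stable_cvg hdot (@resid_contr R mu) (stable_resid mu_singular f)).
Qed.

Lemma sum_bcoef f n :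
  (fun M => \sum_(m < M) sqn (bcoef (slice_coef f n) m)) @ \oo
    --> nrm2 (slice_coef f n).
Proof.
have E : (fun M => \sum_(m < M) sqn (bcoef (slice_coef f n) m)) =
    (fun M => nrm2 (slice_coef f n) - nrm2 (iter M (@kaczw R mu) (slice_coef f n))).
  apply/funext => M; rewrite (nrm2_iter_kacz hdot (dot_one2 mu) (@nrm2_mulwJ R mu) _ M).
  by rewrite addrC addKr.
rewrite E -[X in _ --> X]subr0; apply: cvgB; first exact: cvg_cst.
exact: (stable_cvg hdot (@kaczw_contr R mu) (stable_kaczw _)).
Qed.

(** Pointwise f = E f + z A f with z = e^(2 pi i y), iterated N times. Since |z| = 1, the remainder
    has the norm of A^N f. *)
Lemma resid_expand (f : L2) N (y : T) : f y = \sum_(n < N) slice_coef f n y * ez y ^+ n +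
  ez y ^+ N * iter N (@resid R mu) f y.
Proof.
elim: N => [|N IH]; first by rewrite big_ord0 add0r mul1r.
rewrite {1}IH big_ord_recr -addrA; congr (_ + _).
rewrite (_ : nat_of_ord ord_max = N)// iterS; set g := iter N _ f.
have -> : resid g y = (ez y)^*%C * (g y - slice_coef f N y) by [].
have h : ez y * (ez y)^*%C = 1 by rewrite mulcJ sqn_ez.
rewrite exprSr -mulrA [ez y * (_ * _)]mulrA h; ring.
Qed.

Lemma kaczw_expand (h : L2) M (y : T) : h y = \sum_(m < M) bcoef h m * ef y ^+ m +
  ef y ^+ M * iter M (@kaczw R mu) h y.
Proof.
elim: M => [|M IH]; first by rewrite big_ord0 add0r mul1r.
rewrite {1}IH big_ord_recr -addrA; congr (_ + _).
rewrite (_ : nat_of_ord ord_max = M)// iterS; set g := iter M _ h.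
have -> : kaczw g y = (ef y)^*%C * (g y - bcoef h M * 1) by [].
have e1 : ef y * (ef y)^*%C = 1 by rewrite mulcJ sqn_ef.
rewrite exprSr -mulrA [ef y * (_ * _)]mulrA e1 mulr1; ring.
Qed.

Lemma L2norm_sqn_eq (F G : T -> C) : (forall x, sqn (F x) = sqn (G x)) ->
  L2norm mu F = L2norm mu G.
Proof.
by move=> FG; rewrite !L2normE; congr (_ `^ _)%E; apply: eq_integral => x _; rewrite FG.
Qed.

(** Lets unimodular factors and signs be dropped from the remainders. *)
Lemma L2norm_cvg0 (F : nat -> T -> C) (G : nat -> L2) :
  (forall n x, sqn (F n x) = sqn (G n x)) ->
  (fun n => nrm2 (G n)) @ \oo --> (0 : R) ->
  (fun n => L2norm mu (F n)) @ \oo --> 0%E.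
Proof.
move=> FG G0.
have -> : (fun n => L2norm mu (F n)) = (fun n => (Num.sqrt (nrm2 (G n)))%:E).
  by apply/funext => n; rewrite (L2norm_sqn_eq (FG n)) nrm2_L2norm.
apply: cvg_EFin; first exact: nearW.
rewrite -[X in _ --> X]sqrtr0.
exact: (cvg_comp _ _ G0 (@sqrt_continuous R 0)).
Qed.

(** All terms being nonnegative, the double sum may be taken over m first, which gives |E A^n f|^2,
    and then over n, which gives |f|^2. *)
Lemma cframe_parseval : parseval_frame mu (fun nm : nat * nat => cframe nm.1 nm.2).
Proof.
split=> [j|f Lf]; first exact: L2P.
pose F : L2 := MkL2 Lf.
transitivity (\esum_(j in [set: nat] `*`` (fun=> [set: nat]))
    (sqn (bcoef (slice_coef F j.1) j.2))%:E)%E.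
  have -> : [set: nat] `*`` (fun=> [set: nat]) = [set: nat * nat].
    by apply/seteqP; split.
  by apply: eq_esum => j _; rewrite normc_sq -dot_cframe.
rewrite -(esum_esum (a := fun n m => (sqn (bcoef (slice_coef F n) m))%:E)); last first.
  by move=> n m _ _; rewrite lee_fin sqn_ge0.
transitivity (nrm2 F)%:E; last by rewrite L2norm_sq nrm2E.
transitivity (\esum_(n in [set: nat]) (nrm2 (slice_coef F n))%:E)%E.
  apply: eq_esum => n _; apply: esum_cvg; last exact: sum_bcoef.
  by move=> m; exact: sqn_ge0.
by apply: esum_cvg; [move=> n; exact: (nrm2_ge0 hdot)|exact: sum_slice_coef].
Qed.

Lemma cframe_series (f : T -> C) : inL2 mu f ->
  exists g : nat -> T -> C,
    (forall n : nat,
       L2_series_sum mu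
         (fun (m : nat) (y : R) =>
            inner mu f (cframe n m) * expi (m%:R * (Num.floor y)%:~R)
              * expi (2 * pi * n%:R * y))
         (g n)) /\
    L2_series_sum mu g f.
Proof.
move=> Lf; pose F : L2 := MkL2 Lf.
have zn1 n y : sqn (@ez R y ^+ n) = 1 by rewrite sqnX sqn_ez expr1n.
have wn1 n y : sqn (@ef R y ^+ n) = 1 by rewrite sqnX sqn_ef expr1n.
have gL2 n : inL2 mu (fun y => ez y ^+ n * slice_coef F n y).
  apply: (inL2M (c := 1)); last exact: L2P.
    exact/cmeasurableX/ez_cmeasurable.
  by move=> y; rewrite zn1.
(* The inner sum of index n expands E A^n f, a function of the integer part, and carries the common
   factor e^(2 pi i n y). *)
exists (fun n y => ez y ^+ n * slice_coef F n y); split; last first.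
  split=> //; apply: (L2norm_cvg0 (G := fun N => iter N (@resid R mu) F)).
    move=> N y; rewrite -[f y]/(F y) (resid_expand F N y).
    under eq_bigr do rewrite mulrC.
    by rewrite opprD addrA subrr sub0r sqnN sqnM zn1 mul1r.
  exact: (stable_cvg hdot (@resid_contr R mu) (stable_resid mu_singular F)).
move=> n.
have uE m : (fun y : R => inner mu f (cframe n m) * expi (m%:R * (Num.floor y)%:~R)
    * expi (2 * pi * n%:R * y)) =
    (fun y : T => bcoef (slice_coef F n) m * ef y ^+ m * ez y ^+ n).
  apply/funext => y; rewrite -dot_cframe -[inner mu f _]/(dot F _).
  rewrite expiX; congr (_ * _).
  by rewrite /ez -expiX; congr expi; ring.
split=> //.
  move=> m; rewrite uE; apply: (@inL2_bounded _ _ _ mu _ (sqn (bcoef (slice_coef F n) m))).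
  - exact: mu_fin.
  - apply: cmeasurableM; last exact/cmeasurableX/ez_cmeasurable.
    apply: cmeasurableM; first exact: cmeasurable_cst.
    exact/cmeasurableX/ef_cmeasurable.
  - by move=> y; rewrite !sqnM zn1 wn1 !mulr1.
apply: (L2norm_cvg0 (G := fun M => iter M (@kaczw R mu) (slice_coef F n))).
  move=> M y; rewrite (kaczw_expand (slice_coef F n) M y).
  under eq_bigr => m _ do rewrite (congr1 (fun u => u y) (uE m)).
  by rewrite -mulr_suml mulrC -mulrBr opprD addrA subrr sub0r sqnM sqnN sqnM zn1 wn1 !mul1r.
exact: (stable_cvg hdot (@kaczw_contr R mu) (stable_kaczw _)).
Qed.

End main.

Theorem theorem4p9 (R : realType) (mu : probability (measurableTypeR R) R)
    (mu_singular : mutually_singular (@lebesgue_measure R) mu) :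
  exists c : nat -> nat -> measurableTypeR R -> R[i],
    parseval_frame mu (fun nm : nat * nat => c nm.1 nm.2) /\
    forall f : measurableTypeR R -> R[i], inL2 mu f ->
      exists g : nat -> measurableTypeR R -> R[i],
        (forall n : nat,
           L2_series_sum mu
             (fun (m : nat) (y : R) =>
                inner mu f (c n m) * expi (m%:R * (Num.floor y)%:~R)
                  * expi (2 * pi * n%:R * y))
             (g n)) /\
        L2_series_sum mu g f.
Proof.
exists (fun n m => cframe mu n m); split; first exact: cframe_parseval.
exact: cframe_series.
Qed.
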